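(* Let $\mu\ge -\tfrac12$ and let $a_m,b_m,c_m,d_m,e_m\in\mathbb{R}$ ($m=1,2$) with $b_1,b_2\neq 0$. (1) If $f\in L^1_\mu(\mathbb{R}^2,\mathbb{H})$, then the mapping $w\mapsto \mathbb{D}^{a,b,c}_{d,e,\mu}[f](w)$ is continuous on $\mathbb{R}^2$ and, for all $w\in\mathbb{R}^2$, $$\left|\mathbb{D}^{a,b,c}_{d,e,\mu}[f](w)\right|\le \frac{c_\mu^2}{|b_1b_2|^{\mu+1}}\,\|f\|_{1,\mu}.$$ (2) For every $f\in\mathcal{S}(\mathbb{R}^2,\mathbb{H})$ and every $w=(w_1,w_2)\in\mathbb{R}^2$, $$\mathbb{D}^{a,b,c}_{d,e,\mu}[f](w)=\frac{e^{-\mathbf{i}(c_1w_1^2+e_1w_1)}}{(\mathbf{i}b_1)^{\mu+1}}\;\mathcal{D}^{\mathbb{H}}_\mu[g]\!\left(\frac{w_1}{b_1},\frac{w_2}{b_2}\right)\frac{e^{-\mathbf{j}(c_2w_2^2+e_2w_2)}}{(\mathbf{j}b_2)^{\mu+1}},$$ where $g(v_1,v_2)=e^{-\mathbf{i}(a_1v_1^2+d_1v_1)}\,f(v_1,v_2)\,e^{-\mathbf{j}(a_2v_2^2+d_2v_2)}$.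
   Context: $\mathbb{H}$ denotes Hamilton's quaternions with units $\mathbf{i},\mathbf{j},\mathbf{k}$, conjugation $\overline{q}$ and norm $|q|=\sqrt{q\overline{q}}$. Write $v=(v_1,v_2)$, $w=(w_1,w_2)\in\mathbb{R}^2$, $a=(a_1,a_2)$, and similarly for $b,c,d,e$. Measure and constant: $d\lambda_\mu(v)=|v_1|^{2\mu+1}|v_2|^{2\mu+1}\,dv_1\,dv_2$ on $\mathbb{R}^2$, and $c_\mu=\left(\int_{\mathbb{R}}e^{-x^2/2}|x|^{2\mu+1}dx\right)^{-1}$. $L^1_\mu(\mathbb{R}^2,\mathbb{H})$ is the space of measurable $f:\mathbb{R}^2\to\mathbb{H}$ with $\|f\|_{1,\mu}=\int_{\mathbb{R}^2}|f|\,d\lambda_\mu<\infty$. $\mathcal{S}(\mathbb{R}^2,\mathbb{H})$ is the space of $C^\infty$ functions $f:\mathbb{R}^2\to\mathbb{H}$ with $\sup_x(1+\|x\|)^m|D^\alpha f(x)|<\infty$ for all multi-indices $\alpha$ and $m\in\mathbb{N}$. Dunkl kernel: $j_\mu(x)=\Gamma(\mu+1)\sum_{n\ge0}\frac{(-1)^n}{n!\,\Gamma(n+\mu+1)}\left(\frac{x}{2}\right)^{2n}$ and, for $\mathbf{q}\in\{\mathbf{i},\mathbf{j}\}$ and $x,y\in\mathbb{R}$, $E_\mu(\mathbf{q}x,y)=j_\mu(xy)+\frac{\mathbf{q}xy}{2(\mu+1)}j_{\mu+1}(xy)$. Two-sided quaternion Dunkl transform (QDT): $\mathcal{D}^{\mathbb{H}}_\mu[f](w)=c_\mu^2\int_{\mathbb{R}^2}E_\mu(-\mathbf{i}w_1,v_1)\,f(v)\,E_\mu(-\mathbf{j}w_2,v_2)\,d\lambda_\mu(v)$.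 Two-sided quaternion quadratic-phase Dunkl transform (QQPDT), for $f\in L^1_\mu(\mathbb{R}^2,\mathbb{H})$: $$\mathbb{D}^{a,b,c}_{d,e,\mu}[f](w)=c_\mu^2\int_{\mathbb{R}^2}\Psi^{a_1,b_1,c_1}_{d_1,e_1,\mu}(w_1,v_1)\,f(v)\,\Psi^{a_2,b_2,c_2}_{d_2,e_2,\mu}(w_2,v_2)\,d\lambda_\mu(v),$$ with $\Psi^{a_1,b_1,c_1}_{d_1,e_1,\mu}(w_1,v_1)=\frac{E_\mu(-\mathbf{i}w_1/b_1,v_1)}{(\mathbf{i}b_1)^{\mu+1}}e^{-\mathbf{i}(a_1v_1^2+c_1w_1^2+d_1v_1+e_1w_1)}$ and $\Psi^{a_2,b_2,c_2}_{d_2,e_2,\mu}(w_2,v_2)=\frac{E_\mu(-\mathbf{j}w_2/b_2,v_2)}{(\mathbf{j}b_2)^{\mu+1}}e^{-\mathbf{j}(a_2v_2^2+c_2w_2^2+d_2v_2+e_2w_2)}$. For $\mathbf{q}\in\{\mathbf{i},\mathbf{j}\}$ and real $t\ne0$, $(\mathbf{q}t)^{\mu+1}=|t|^{\mu+1}e^{\mathbf{q}\,\mathrm{sgn}(t)(\mu+1)\pi/2}$ (principal value in $\mathbb{R}+\mathbf{q}\mathbb{R}\cong\mathbb{C}$). *)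

(* Defs.v *)
From HB Require Import structures.
From mathcomp Require Import all_boot all_order all_algebra.
From mathcomp Require Import ring lra.
From mathcomp Require Import all_classical all_reals all_analysis measurable_realfun.

Set Implicit Arguments.
Unset Strict Implicit.
Unset Printing Implicit Defensive.

Import Order.TTheory GRing.Theory Num.Theory.
Import numFieldNormedType.Exports.

Local Open Scope classical_set_scope.
Local Open Scope ring_scope.

Record quat (R : Type) := Quat { qre : R; qim_i : R; qim_j : R; qim_k : R }.

Definition tuple_of_quat (R : Type) (q : quat R) : R * R * R * R :=
  (qre q, qim_i q, qim_j q, qim_k q).
Definition quat_of_tuple (R : Type) (t : R * R * R * R) : quat R :=
  let: (a, b, c, d) := t in Quat a b c d.

Lemma tuple_of_quatK (R : Type) : cancel (@tuple_of_quat R) (@quat_of_tuple R).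
Proof. by case. Qed.

HB.instance Definition _ (R : choiceType) :=
  Choice.copy (quat R) (can_type (@tuple_of_quatK R)).

Section QuatAlgebra.
Variable R : realType.
Implicit Types (p q r : quat R) (a b : R).

Lemma quatP p q : qre p = qre q -> qim_i p = qim_i q -> qim_j p = qim_j q ->
  qim_k p = qim_k q -> p = q.
Proof. by case: p q => ? ? ? ? [? ? ? ?] /= -> -> -> ->. Qed.

Definition addq p q := Quat (qre p + qre q) (qim_i p + qim_i q)
  (qim_j p + qim_j q) (qim_k p + qim_k q).
Definition oppq p := Quat (- qre p) (- qim_i p) (- qim_j p) (- qim_k p).

Fact addqA : associative addq.
Proof. by move=> p q r; apply: quatP => /=; ring. Qed.
Fact addqC : commutative addq.
Proof. by move=> p q; apply: quatP => /=; ring. Qed.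
Fact add0q : left_id (Quat 0 0 0 0) addq.
Proof. by move=> p; apply: quatP => /=; ring. Qed.
Fact addNq : left_inverse (Quat 0 0 0 0) oppq addq.
Proof. by move=> p; apply: quatP => /=; ring. Qed.

HB.instance Definition _ :=
  GRing.isZmodule.Build (quat R) addqA addqC add0q addNq.

Definition mulq p q := Quat
  (qre p * qre q - qim_i p * qim_i q - qim_j p * qim_j q - qim_k p * qim_k q)
  (qre p * qim_i q + qim_i p * qre q + qim_j p * qim_k q - qim_k p * qim_j q)
  (qre p * qim_j q - qim_i p * qim_k q + qim_j p * qre q + qim_k p * qim_i q)
  (qre p * qim_k q + qim_i p * qim_j q - qim_j p * qim_i q + qim_k p * qre q).

Fact mulqA : associative mulq.
Proof. by move=> p q r; apply: quatP => /=; ring. Qed.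
Fact mul1q : left_id (Quat 1 0 0 0) mulq.
Proof. by move=> p; apply: quatP => /=; ring. Qed.
Fact mulq1 : right_id (Quat 1 0 0 0) mulq.
Proof. by move=> p; apply: quatP => /=; ring. Qed.
Fact mulqDl : left_distributive mulq addq.
Proof. by move=> p q r; apply: quatP => /=; ring. Qed.
Fact mulqDr : right_distributive mulq addq.
Proof. by move=> p q r; apply: quatP => /=; ring. Qed.
Fact oneq_neq0 : Quat 1 0 0 0 != 0 :> quat R.
Proof. by apply/eqP => -[] /eqP; rewrite oner_eq0. Qed.

HB.instance Definition _ := GRing.Zmodule_isNzRing.Build (quat R)
  mulqA mul1q mulq1 mulqDl mulqDr oneq_neq0.

Definition scaleq a q := Quat (a * qre q) (a * qim_i q) (a * qim_j q) (a * qim_k q).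

Fact scaleqA a b q : scaleq a (scaleq b q) = scaleq (a * b) q.
Proof. by apply: quatP => /=; ring. Qed.
Fact scale1q : left_id 1 scaleq.
Proof. by move=> q; apply: quatP => /=; ring. Qed.
Fact scaleqDr : right_distributive scaleq +%R.
Proof. by move=> a p q; apply: quatP => /=; ring. Qed.
Fact scaleqDl q : {morph scaleq^~ q : a b / a + b}.
Proof. by move=> a b; apply: quatP => /=; ring. Qed.

HB.instance Definition _ := GRing.Zmodule_isLmodule.Build R (quat R)
  scaleqA scale1q scaleqDr scaleqDl.

Fact scaleqAl a p q : a *: (p * q) = (a *: p) * q.
Proof. by apply: quatP => /=; ring. Qed.
Fact scaleqAr a p q : a *: (p * q) = p * (a *: q).
Proof. by apply: quatP => /=; ring. Qed.

HB.instance Definition _ := GRing.Lmodule_isLalgebra.Build R (quat R) scaleqAl.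
HB.instance Definition _ := GRing.Lalgebra_isAlgebra.Build R (quat R) scaleqAr.

Definition conjq q := Quat (qre q) (- qim_i q) (- qim_j q) (- qim_k q).

(* [q * conjq q] is real, so its real part carries all the information *)
Definition sqnormq q := qre (q * conjq q).

Lemma mul_conjq q : q * conjq q = (sqnormq q)%:A.
Proof. by apply: quatP; rewrite /sqnormq /=; ring. Qed.

Lemma mulConjq q : conjq q * q = (sqnormq q)%:A.
Proof. by apply: quatP; rewrite /sqnormq /=; ring. Qed.

Lemma sqnormqE q :
  sqnormq q = qre q ^+ 2 + qim_i q ^+ 2 + qim_j q ^+ 2 + qim_k q ^+ 2.
Proof. by rewrite /sqnormq /=; ring. Qed.

Lemma sqnormq_ge0 q : 0 <= sqnormq q.
Proof. by rewrite sqnormqE !addr_ge0 ?sqr_ge0. Qed.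

Lemma sqnormq_eq0 q : (sqnormq q == 0) = (q == 0).
Proof.
apply/eqP/eqP => [|->]; last by rewrite sqnormqE /= !expr0n /= !addr0.
rewrite sqnormqE => /eqP; rewrite !paddr_eq0 ?addr_ge0 ?sqr_ge0//.
rewrite !sqrf_eq0 => /andP[/andP[/andP[/eqP ? /eqP ?] /eqP ?] /eqP ?].
exact: quatP.
Qed.

Definition invq q := (sqnormq q)^-1 *: conjq q.

Fact mulVq : {in [pred q : quat R | q != 0], left_inverse 1 invq *%R}.
Proof.
move=> q; rewrite inE /= => q0.
by rewrite /invq -scalerAl mulConjq scalerA mulVf ?scale1r// sqnormq_eq0.
Qed.

Fact mulqV : {in [pred q : quat R | q != 0], right_inverse 1 invq *%R}.
Proof.
move=> q; rewrite inE /= => q0.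
by rewrite /invq -scalerAr mul_conjq scalerA mulVf ?scale1r// sqnormq_eq0.
Qed.

Fact unitqP p q : q * p = 1 /\ p * q = 1 -> [pred q : quat R | q != 0] p.
Proof.
by move=> [qp _] /=; apply: contra_eq_neq qp => ->; rewrite mulr0 eq_sym oner_neq0.
Qed.

Fact invq_out : {in [predC [pred q : quat R | q != 0]], invq =1 id}.
Proof.
move=> q; rewrite !inE negbK => /eqP ->.
by apply: quatP; rewrite /= ?oppr0 mulr0.
Qed.

HB.instance Definition _ :=
  GRing.NzRing_hasMulInverse.Build (quat R) mulVq mulqV unitqP invq_out.

Definition normq q := Num.sqrt (sqnormq q).

Fact ler_normqD p q : normq (p + q) <= normq p + normq q.
Proof.
have H0 : 0 <= normq p + normq q by rewrite addr_ge0 ?sqrtr_ge0.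
rewrite -(ler_pXn2r (ltn0Sn 1)) ?nnegrE ?sqrtr_ge0//.
rewrite sqrrD !sqr_sqrtr ?sqnormq_ge0//.
pose dot := qre p * qre q + qim_i p * qim_i q + qim_j p * qim_j q + qim_k p * qim_k q.
have -> : sqnormq (p + q) = sqnormq p + dot *+ 2 + sqnormq q.
  by rewrite !sqnormqE /dot /=; ring.
rewrite lerD2r lerD2l lerMn2r /= (le_trans (ler_norm _))//.
rewrite -sqrtr_sqr -sqrtrM ?sqnormq_ge0// ler_wsqrtr//.
rewrite -subr_ge0 !sqnormqE /dot.
have -> : forall x y z t x' y' z' t' : R,
  (x ^+ 2 + y ^+ 2 + z ^+ 2 + t ^+ 2) * (x' ^+ 2 + y' ^+ 2 + z' ^+ 2 + t' ^+ 2) -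
  (x * x' + y * y' + z * z' + t * t') ^+ 2 =
  (x * y' - y * x') ^+ 2 + (x * z' - z * x') ^+ 2 + (x * t' - t * x') ^+ 2 +
  (y * z' - z * y') ^+ 2 + (y * t' - t * y') ^+ 2 + (z * t' - t * z') ^+ 2.
  by move=> *; ring.
by rewrite !addr_ge0 ?sqr_ge0.
Qed.

Fact normqZ a q : normq (a *: q) = `|a| * normq q.
Proof.
have -> : normq (a *: q) = Num.sqrt (a ^+ 2 * sqnormq q).
  by rewrite /normq !sqnormqE /=; congr Num.sqrt; ring.
by rewrite sqrtrM ?sqr_ge0// sqrtr_sqr.
Qed.

Fact normq_eq0 q : normq q = 0 -> q = 0.
Proof.
by move/eqP; rewrite sqrtr_eq0 => h; apply/eqP; rewrite -sqnormq_eq0 eq_le h sqnormq_ge0.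
Qed.

(* makes [`|q|] the quaternion norm, and gives [quat R] the induced topology *)
HB.instance Definition _ :=
  Lmodule_isNormed.Build R (quat R) ler_normqD normqZ normq_eq0.

End QuatAlgebra.

Section Definitions.
Variable R : realType.
Implicit Types (mu x y t : R) (q : quat R) (f g : R * R -> quat R) (v w : R * R).

Definition quat_i : quat R := Quat 0 1 0 0.
Definition quat_j : quat R := Quat 0 0 1 0.
Definition quat_k : quat R := Quat 0 0 0 1.

Lemma quat_relations :
  [/\ quat_i * quat_i = -1, quat_j * quat_j = -1, quat_k * quat_k = -1 &
      quat_i * quat_j * quat_k = -1].
Proof. by split; apply: quatP => /=; ring. Qed.

(* [expq q t] is e^(q t) and [powq q t s] is (q t)^s (principal value),
   for a unit imaginary quaternion q, under R + q R ~ C *)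
Definition expq q t : quat R := (cos t)%:A + sin t *: q.
Definition powq q t (s : R) : quat R :=
  (`|t| `^ s) *: expq q (Num.sg t * s * pi / 2).

(* Euler's integral, which converges only for 0 < x *)
Definition Gamma x : R :=
  \int[lebesgue_measure]_(t in `]0, +oo[) (t `^ (x - 1) * expR (- t)).

Definition dunkl_j mu x : R :=
  Gamma (mu + 1) *
  limn (series (fun n =>
    (-1) ^+ n / (n`!%:R * Gamma (n%:R + mu + 1)) * (x / 2) ^+ (2 * n))).

(* the Dunkl kernel E_mu(q x, y) *)
Definition dunkl_E mu q x y : quat R :=
  (dunkl_j mu (x * y))%:A +
  (x * y / (2 * (mu + 1)) * dunkl_j (mu + 1) (x * y)) *: q.

Definition dunkl_c mu : R :=
  (\int[lebesgue_measure]_x (expR (- (x ^+ 2 / 2)) * `|x| `^ (2 * mu + 1)))^-1.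

Definition dunkl_weight mu v : R :=
  `|v.1| `^ (2 * mu + 1) * `|v.2| `^ (2 * mu + 1).

Definition dunkl_measure mu
    (A : set (R * R)) : \bar R :=
  (\int[lebesgue_measure \x lebesgue_measure]_(v in A)
    (dunkl_weight mu v)%:E)%E.

Lemma dunkl_weight_ge0 mu v : 0 <= dunkl_weight mu v.
Proof. by rewrite mulr_ge0 ?powR_ge0. Qed.

Lemma measurable_dunkl_weight mu : measurable_fun
  [set: R * R] (dunkl_weight mu).
Proof.
apply: measurable_funM; apply: (measurableT_comp (measurable_powR _)) => //;
  exact: measurableT_comp.
Qed.

Fact dunkl_measure0 mu : dunkl_measure mu set0 = 0%E.
Proof. exact: integral_set0. Qed.

Fact dunkl_measure_ge0 mu A : (0 <= dunkl_measure mu A)%E.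
Proof. by apply: integral_ge0 => v _; rewrite lee_fin dunkl_weight_ge0. Qed.

Fact dunkl_measure_sigma_additive mu : semi_sigma_additive (dunkl_measure mu).
Proof.
move=> /= A mA tA mUA; rewrite /dunkl_measure ge0_integral_bigcup//.
- apply: is_cvg_ereal_nneg_natsum_cond => n _ _.
  exact: dunkl_measure_ge0.
- apply: measurable_funTS; apply/measurable_EFinP.
  exact: measurable_dunkl_weight.
- by move=> v _; rewrite lee_fin dunkl_weight_ge0.
Qed.

HB.instance Definition _ mu := isMeasure.Build _ _ _ (dunkl_measure mu)
  (dunkl_measure0 mu) (@dunkl_measure_ge0 mu)
  (@dunkl_measure_sigma_additive mu).

Definition dunkl_norm1 mu f : \bar R :=
  (\int[dunkl_measure mu]_v (`|f v|%:E))%E.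

(* measurability is with respect to the Borel sigma-algebra of [quat R] *)
Definition dunkl_L1 mu f : Prop :=
  measurable_fun [set: R * R]
    (f : _ -> g_sigma_algebraType (@open (quat R))) /\
  (dunkl_norm1 mu f < +oo)%E.

(* vector-valued integral, taken componentwise *)
Definition qintegral mu f : quat R := Quat
  (\int[dunkl_measure mu]_v qre (f v)) (\int[dunkl_measure mu]_v qim_i (f v))
  (\int[dunkl_measure mu]_v qim_j (f v)) (\int[dunkl_measure mu]_v qim_k (f v)).

Fixpoint diff_class (n : nat) f : Prop :=
  continuous f /\
  if n is n'.+1 then
    [/\ forall v, derivable f v (1, 0), forall v, derivable f v (0, 1),
        diff_class n' ('D_(1, 0) f) & diff_class n' ('D_(0, 1) f)]
  else True.

Definition smooth f : Prop := forall n, diff_class n f.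

Definition partialD (alpha : nat * nat) f : R * R -> quat R :=
  iter alpha.1 (fun g => 'D_(1, 0) g) (iter alpha.2 (fun g => 'D_(0, 1) g) f).

(* not [`|v|], which is the maximum norm on R * R *)
Definition euclidean_norm v : R := Num.sqrt (v.1 ^+ 2 + v.2 ^+ 2).

Definition schwartz f : Prop :=
  smooth f /\
  forall (alpha : nat * nat) (m : nat),
    has_ubound [set (1 + euclidean_norm v) ^+ m * `|partialD alpha f v|
               | v in [set: R * R]].

Definition QDT mu f w : quat R :=
  (dunkl_c mu ^+ 2) *: qintegral mu (fun v =>
    dunkl_E mu quat_i (- w.1) v.1 * f v * dunkl_E mu quat_j (- w.2) v.2).

(* one-dimensional quadratic-phase Dunkl kernel along the imaginary unit q *)
Definition qpd_kernel mu q (a b c d e : R) (w v : R) : quat R :=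
  dunkl_E mu q (- (w / b)) v / powq q b (mu + 1) *
  expq q (- (a * v ^+ 2 + c * w ^+ 2 + d * v + e * w)).

Definition QQPDT mu (a b c d e : R * R) f w : quat R :=
  (dunkl_c mu ^+ 2) *: qintegral mu (fun v =>
    qpd_kernel mu quat_i a.1 b.1 c.1 d.1 e.1 w.1 v.1 * f v *
    qpd_kernel mu quat_j a.2 b.2 c.2 d.2 e.2 w.2 v.2).

End Definitions.

Arguments quat_i {R}.
Arguments quat_j {R}.
Arguments quat_k {R}.

(* Main.v *)
Require Import Defs.
From HB Require Import structures.
From mathcomp Require Import all_boot all_order all_algebra.
From mathcomp Require Import ring lra.
From mathcomp Require Import all_classical all_reals all_analysis measurable_realfun.

Import Order.TTheory GRing.Theory Num.Theory.
Import numFieldNormedType.Exports.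

Local Open Scope classical_set_scope.
Local Open Scope ring_scope.

(** Everything rests on one estimate: for mu >= -1/2 the Dunkl kernel has
modulus at most 1, that is, j_mu^2 + (j_mu')^2 <= 1 on the real line.  Write
j_mu(x) = F((x/2)^2), where F = 0F1(; a; - y) and a = mu + 1.  The derivative
of F is a multiple of the series with parameter a + 1, and a contiguity
relation between three consecutive parameters is the Bessel equation
y F'' + a F' + F = 0.  Hence the energy F^2 + y F'^2, which is the squared
modulus of the kernel, has derivative - (2 a - 1) F'^2 <= 0; it equals 1 at
y = 0, so it is at most 1 for y >= 0 ([bessel_energy_le1]).  The series has this form because
Gamma(n + a) is the rising factorial of a times Gamma(a), which requires Euler's
integral to be finite and positive and to satisfy its functional equation
([GammaS]).

The remaining factors of a kernel are unit quaternions and the inverse of a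
quaternion of norm |b|^(mu+1), and the quaternion norm is multiplicative.
The integrand of the transform is therefore at most
|b.1 b.2|^-(mu+1) |f|, uniformly in w.  This bound gives the norm inequality
([qintegral_norm_le]) and also dominates the integrand as w varies; since the
kernels are continuous in w, dominated convergence gives the continuity of the
transform ([continuous_Rintegral]).

The factorization through the QDT is algebraic: all factors of the left kernel
lie in the commutative field R + iR and all factors of the right kernel in
R + jR, so the factors independent of v can be moved to the outer ends and
taken out of the integral.  Taking them out requires the inner integrand to be
integrable; for a Schwartz function this holds because it decays faster than
the weight grows ([schwartz_qL1]). *)

(** * Euler's Gamma integral on the positive reals *)
Section Gamma.
Context {R : realType}.
Implicit Types x t : R.

Definition gamma_integrand x t : R := t `^ (x - 1) * expR (- t).

(** Kept in the extended reals: the functional equation is proved without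
finiteness, and then carries finiteness from x + 1 to x. *)
Definition egamma x : \bar R :=
  (\int[lebesgue_measure]_(t in `]0%R, +oo[) (gamma_integrand x t)%:E)%E.

Lemma gamma_integrand_ge0 x t : 0 <= gamma_integrand x t.
Proof. by rewrite mulr_ge0 ?powR_ge0 ?expR_ge0. Qed.

Lemma measurable_gamma_integrand x (D : set R) :
  measurable_fun D (gamma_integrand x).
Proof.
apply: measurable_funTS; apply: measurable_funM; first exact: measurable_powR.
by apply: measurableT_comp => //; exact: measurable_expR.
Qed.

(** The offset 2 makes the left endpoint positive and smaller than the right
one for every n. *)
Definition cutoff (n : nat) : set R := `[n.+2%:R^-1, n.+2%:R]%classic.

Lemma cutoff_nondecreasing : nondecreasing_seq cutoff.
Proof.
move=> m n mn; apply/subsetPset => t; rewrite /cutoff/= !in_itv/= => /andP[h1 h2].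
apply/andP; split.
  by apply: le_trans h1; rewrite lef_pV2 ?posrE// ler_nat !ltnS.
by apply: le_trans h2 _; rewrite ler_nat !ltnS.
Qed.

Lemma bigcup_cutoff : \bigcup_n cutoff n = `]0, +oo[%classic :> set R.
Proof.
apply/seteqP; split => t.
  move=> [n _]; rewrite /cutoff/= !in_itv/= andbT => /andP[h _].
  by apply: lt_le_trans h; rewrite invr_gt0.
rewrite /= in_itv/= andbT => t0.
have [m hm] : exists m : nat, t < m%:R /\ t^-1 < m%:R.
  exists (maxn (Num.truncn t).+1 (Num.truncn t^-1).+1).
  by split; [apply: lt_le_trans (truncnS_gt t) _|apply: lt_le_trans (truncnS_gt t^-1) _];
    rewrite ler_nat leq_max leqnn ?orbT.
exists m => //; rewrite /cutoff/= in_itv/=; apply/andP; split.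
  rewrite -[leRHS]invrK lef_pV2 ?posrE ?invr_gt0//.
  by rewrite (le_trans (ltW hm.2))// ler_nat ltnW.
by rewrite (le_trans (ltW hm.1))// ler_nat ltnW.
Qed.

Lemma cvg_egamma x :
  (\int[lebesgue_measure]_(t in cutoff n) (gamma_integrand x t)%:E)%E @[n --> \oo] --> egamma x.
Proof.
rewrite /egamma -bigcup_cutoff.
apply: ge0_nondecreasing_set_cvg_integral => //.
- exact: cutoff_nondecreasing.
- by move=> i; exact: measurable_itv.
- by move=> i; apply/measurable_EFinP; exact: measurable_gamma_integrand.
- by move=> i t _; rewrite lee_fin gamma_integrand_ge0.
Qed.

Lemma continuous_gamma_integrand x t : 0 < t ->
  {for t, continuous (gamma_integrand x)}.
Proof.
move=> t0; apply: continuousM.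
  apply: differentiable_continuous; apply/derivable1_diffP.
  by apply: derivable_powR; rewrite in_itv/= t0.
by apply: continuous_comp; [exact: opp_continuous|exact: continuous_expR].
Qed.

(** Away from 0 the power functions are smooth whatever their exponent, so that
parts can be integrated also for x < 1. *)
Lemma gamma_parts x n : 0 < x ->
  (\int[lebesgue_measure]_(t in cutoff n) (gamma_integrand (x + 1) t)%:E =
   (gamma_integrand (x + 1) n.+2%:R^-1 - gamma_integrand (x + 1) n.+2%:R)%:E
   + x%:E * \int[lebesgue_measure]_(t in cutoff n) (gamma_integrand x t)%:E)%E.
Proof.
move=> x0.
have ab : n.+2%:R^-1 < n.+2%:R :> R.
  by rewrite (@lt_trans _ _ 1)// ?invf_lt1 ?ltr1n.
have pos t : t \in `[n.+2%:R^-1, n.+2%:R] -> 0 < t.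
  by rewrite in_itv/= => /andP[h _]; apply: lt_le_trans h; rewrite invr_gt0.
have poso t : t \in `]n.+2%:R^-1, n.+2%:R[ -> 0 < t.
  by rewrite in_itv/= => /andP[h _]; apply: lt_trans h; rewrite invr_gt0.
have cpow y t : 0 < t -> {for t, continuous ((@powR R) ^~ y)}.
  move=> t0; apply: differentiable_continuous; apply/derivable1_diffP.
  by apply: derivable_powR; rewrite in_itv/= t0.
have cexp t : {for t, continuous (fun t => - expR (- t) : R)}.
  apply: continuousN.
  by apply: continuous_comp; [exact: opp_continuous|exact: continuous_expR].
have cexp' t : {for t, continuous (fun t => expR (- t) : R)}.
  by apply: continuous_comp; [exact: opp_continuous|exact: continuous_expR].
have H := @integration_by_parts R (fun t => t `^ x) (fun t => - expR (- t))
  (fun t => x * t `^ (x - 1)) (fun t => expR (- t)) _ _ ab.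
rewrite /cutoff.
under eq_integral.
  move=> t _; rewrite /gamma_integrand addrK; over.
rewrite H; clear H.
- under [X in (_ - X)%E]eq_integral.
    move=> t _.
    have -> : (x * t `^ (x - 1) * - expR (- t))%:E =
        ((- x)%:E * (gamma_integrand x t)%:E)%E.
      by rewrite -EFinM /gamma_integrand; congr EFin; ring.
    over.
  rewrite integralZl//.
    rewrite EFinN mulNe oppeK; congr (_%:E + _)%E.
    by rewrite /gamma_integrand addrK; ring.
  apply: continuous_compact_integrable; first exact: segment_compact.
  apply: continuous_in_subspaceT => t; rewrite inE => /pos t0.
  exact: continuous_gamma_integrand.
- apply: continuous_in_subspaceT => t; rewrite inE => /pos t0.
  by apply: cvgM; [exact: cvg_cst|exact: cpow].
- split.
  + by move=> t /poso t0; apply: derivable_powR; rewrite in_itv/= t0.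
  + by apply: cvg_at_right_filter; exact: cpow.
  + by apply: cvg_at_left_filter; exact: cpow.
- by move=> t /poso t0; rewrite powR_derive1// in_itv/= t0.
- by apply: continuous_in_subspaceT => t _; exact: cexp'.
- split.
  + by move=> t _; exact: ex_derive.
  + by apply: cvg_at_right_filter; exact: cexp.
  + by apply: cvg_at_left_filter; exact: cexp.
- by move=> t _; rewrite derive1E derive_val; rewrite /GRing.scale/=; ring.
Qed.

(** The inequality u <= expR u at u = t / (2 x), raised to the power x.  Only
half of the exponent is spent: the other half keeps the Gamma integrand
integrable at infinity. *)
Lemma powR_le_expR x t : 0 < x -> 0 <= t ->
  t `^ x <= (2 * x) `^ x * expR (t / 2).
Proof.
move=> x0 t0; have c0 : 0 < 2 * x by rewrite mulr_gt0.
have -> : expR (t / 2) = expR (t / (2 * x)) `^ x.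
  rewrite -expRM; congr expR; field.
  by rewrite gt_eqF.
rewrite -powRM ?expR_ge0 ?(ltW c0)//.
apply: ge0_ler_powR; rewrite ?nnegrE ?(ltW x0)// ?mulr_ge0 ?expR_ge0 ?(ltW x0)//.
rewrite -[leLHS](mulfVK (lt0r_neq0 c0)) mulrC ler_pM2l//.
by apply: le_trans (expR_ge1Dx _); rewrite lerDr.
Qed.

Lemma gamma_integrand_le x t : 0 < x -> 0 <= t ->
  gamma_integrand (x + 1) t <= (2 * x) `^ x * expR (- (2^-1 * t)).
Proof.
move=> x0 t0; rewrite /gamma_integrand addrK.
have -> : (2 * x) `^ x * expR (- (2^-1 * t)) =
  ((2 * x) `^ x * expR (t / 2)) * expR (- t).
  by rewrite -mulrA -expRD; congr (_ * expR _); field.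
by rewrite ler_wpM2r ?expR_ge0 ?powR_le_expR.
Qed.

Lemma cvg_expR_half : expR (- (2^-1 * t)) @[t --> +oo%R] --> (0 : R).
Proof.
rewrite (_ : (fun x => expR (- (2^-1 * x))) =
             (fun z : R => expR (- z)) \o (fun z => 2^-1 * z)); last by [].
apply: (@cvg_comp _ _ _ _ _ _ (pinfty_nbhs R)); last exact: cvgr_expR.
exact: gt0_cvgMry.
Qed.

Lemma integral_expR_half :
  (\int[lebesgue_measure]_(t in `]0%R, +oo[) (expR (- (2^-1 * t)))%:E = 2%:E :> \bar R)%E.
Proof.
have cexp : continuous (fun t : R => expR (- (2^-1 * t))).
  move=> t; apply: continuous_comp; last exact: continuous_expR.
  by apply: cvgN; apply: cvgM; [exact: cvg_cst|exact: cvg_id].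
rewrite integral_itv_obnd_cbnd; last first.
  apply/measurable_EFinP; apply: measurable_funTS.
  exact: continuous_measurable_fun.
rewrite (@ge0_continuous_FTC2y _ _ (fun t => - 2 * expR (- (2^-1 * t))) _ 0)//.
- by rewrite mulr0 oppr0 expR0 mulr1 EFinN oppeK add0e.
- exact: continuous_subspaceT.
- rewrite -(mulr0 (-2)); apply: cvgM; first exact: cvg_cst.
  exact: cvg_expR_half.
- by apply: cvg_at_right_filter; apply: cvgM; [exact: cvg_cst|exact: cexp].
- by move=> t _; rewrite derive1E derive_val /GRing.scale/=; field.
Qed.

Lemma egamma_ge0 x : (0 <= egamma x)%E.
Proof. by apply: integral_ge0 => t _; rewrite lee_fin gamma_integrand_ge0. Qed.

(** Arguments above 1 come first: there the integrand is bounded near 0. *)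
Lemma egammaS_lty x : 0 < x -> (egamma (x + 1) < +oo)%E.
Proof.
move=> x0.
have mexp : measurable_fun setT (fun t : R => expR (- (2^-1 * t))).
  apply: measurableT_comp; first exact: measurable_expR.
  by apply: measurableT_comp => //; apply: measurable_funM.
apply: (@le_lt_trans _ _ (\int[lebesgue_measure]_(t in `]0%R, +oo[)
    (((2 * x) `^ x)%:E * (expR (- (2^-1 * t)))%:E))%E).
  apply: ge0_le_integral => //=.
  - by move=> t _; rewrite lee_fin gamma_integrand_ge0.
  - by apply/measurable_EFinP; exact: measurable_gamma_integrand.
  - by apply/measurable_EFinP; apply: measurable_funTS; apply: measurable_funM.
  - move=> t; rewrite in_itv/= andbT => t0.
    by rewrite lee_fin gamma_integrand_le// ltW.
rewrite ge0_integralZl_EFin ?powR_ge0//.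
- by rewrite integral_expR_half -EFinM ltry.
- by apply/measurable_EFinP; exact: measurable_funTS.
Qed.

Lemma cvg_gamma_boundary x : 0 < x ->
  gamma_integrand (x + 1) n.+2%:R^-1 - gamma_integrand (x + 1) n.+2%:R
    @[n --> \oo] --> 0.
Proof.
move=> x0; rewrite -(subr0 0); apply: cvgB.
- apply: (@squeeze_cvgr _ _ _ _ (fun=> 0) (fun n => n.+2%:R^-1 `^ x)).
  + near=> n; rewrite gamma_integrand_ge0/= /gamma_integrand addrK.
    by rewrite ler_piMr ?powR_ge0// -[leRHS]expR0 ler_expR oppr_le0.
  + exact: cvg_cst.
    apply: (@cvg_comp _ _ _ (fun n => n.+2%:R^-1 : R) ((@powR R) ^~ x) _ (0^'+));
      last exact: powR_cvg0.
    move=> A [e /= e0 eA].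
    have : \forall n \near \oo, `|(0 : R) - n.+1%:R^-1| < e.
      by apply: (@cvgr_dist_lt _ _ _ _ _ _ 0) => //; exact: cvg_harmonic.
    move=> [N _ hN]; exists N => // n /= Nn; apply: eA => /=; last by rewrite invr_gt0.
    by apply: (hN n.+1); rewrite /= (leq_trans Nn).
- apply: (@squeeze_cvgr _ _ _ _ (fun=> 0)
    (fun n => (2 * x) `^ x * expR (- (2^-1 * n.+2%:R)))).
  + by near=> n; rewrite gamma_integrand_ge0/= gamma_integrand_le.
  + exact: cvg_cst.
  + rewrite -(mulr0 ((2 * x) `^ x)); apply: cvgM; first exact: cvg_cst.
    apply: (@cvg_comp _ _ _ (fun n => n.+2%:R : R)
      (fun t => expR (- (2^-1 * t))) _ (pinfty_nbhs R)); last exact: cvg_expR_half.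
    apply/cvgryPge => M; near=> n.
    apply: (@le_trans _ _ n%:R); last by rewrite ler_nat ltnW.
    by near: n; exact: nbhs_infty_ger.
Unshelve. all: end_near.
Qed.

(** Monotone convergence along the cutoff intervals applies without knowing
that the integrals are finite, and the boundary terms tend to 0. *)
Lemma egammaS x : 0 < x -> egamma (x + 1) = (x%:E * egamma x)%E.
Proof.
move=> x0.
have h1 := @cvg_egamma (x + 1).
have h2 : (\int[lebesgue_measure]_(t in cutoff n) (gamma_integrand (x + 1) t)%:E)%E
    @[n --> \oo] --> (0%:E + x%:E * egamma x)%E.
  under eq_fun do rewrite gamma_parts//.
  apply: cvgeD; first by rewrite fin_num_adde_defr.
    by apply: cvg_EFin; [exact: nearW|exact: cvg_gamma_boundary].
  by apply: cvgeZl => //; exact: cvg_egamma.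
by rewrite (cvg_unique _ h1 h2)// add0e.
Qed.

(** By the functional equation, an infinite value at x would force an infinite
value at x + 1. *)
Lemma egamma_lty x : 0 < x -> (egamma x < +oo)%E.
Proof.
move=> x0; have := @egammaS_lty x x0; rewrite egammaS//.
have := egamma_ge0 x.
case: (egamma x) => [r _ _|_|//]; first by rewrite ltry.
by rewrite gt0_muley// lte_fin.
Qed.

(** On [1, 2] the power t `^ (x - 1) is at least t^-1, hence at least 1/2. *)
Lemma egamma_gt0 x : 0 < x -> (0 < egamma x)%E.
Proof.
move=> x0; apply: (@lt_le_trans _ _
    (\int[lebesgue_measure]_(t in `[1%R, 2%R]) (2^-1 * expR (- 2))%:E)%E).
  rewrite integral_cst//= lebesgue_measure_itv/= lte_fin ltr1n/=.
  by rewrite -EFinD -EFinM lte_fin mulr_gt0 ?mulr_gt0 ?expR_gt0//; lra.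
apply: (@le_trans _ _
    (\int[lebesgue_measure]_(t in `[1%R, 2%R]) (gamma_integrand x t)%:E)%E).
  apply: ge0_le_integral => //=.
  - by apply/measurable_EFinP; exact: measurable_gamma_integrand.
  - move=> t; rewrite in_itv/= => /andP[t1 t2].
    rewrite lee_fin ler_pM ?expR_ge0 ?ler_expR ?lerN2//.
    apply: (@le_trans _ _ (t `^ (-1))).
      rewrite powR_inv1 ?(le_trans _ t1)// lef_pV2 ?posrE//.
      exact: lt_le_trans t1.
    by apply: ler_powR => //; lra.
apply: ge0_subset_integral => //=.
- by apply/measurable_EFinP; exact: measurable_gamma_integrand.
- by move=> t _; rewrite lee_fin gamma_integrand_ge0.
- move=> t; rewrite /= !in_itv/= andbT => /andP[t1 _].
  exact: lt_le_trans t1.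
Qed.

Lemma GammaE x : Gamma x = fine (egamma x).
Proof. by []. Qed.

Lemma Gamma_gt0 x : 0 < x -> 0 < Gamma x.
Proof. by move=> x0; rewrite GammaE fine_gt0// egamma_gt0// egamma_lty. Qed.

Lemma GammaS x : 0 < x -> Gamma (x + 1) = x * Gamma x.
Proof.
by move=> x0; rewrite !GammaE egammaS// fineM// ge0_fin_numE ?egamma_lty ?egamma_ge0.
Qed.

End Gamma.

(** * The normalized Bessel series and its energy *)
Section BesselSeries.
Context {R : realType}.
Implicit Types (a x y : R) (n : nat).

Definition rising a n : R := \prod_(i < n) (a + i%:R).

Lemma rising_recr a n : rising a n.+1 = rising a n * (a + n%:R).
Proof. by rewrite /rising big_ord_recr. Qed.

Lemma rising_recl a n : rising a n.+1 = a * rising (a + 1) n.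
Proof.
rewrite /rising big_ord_recl addr0; congr (_ * _); apply: eq_bigr => i _.
by rewrite -addrA nat1r.
Qed.

Lemma rising_ge a n : 0 < a -> a ^+ n <= rising a n.
Proof.
move=> a0; elim: n => [|n IH]; first by rewrite /rising big_ord0 expr0.
by rewrite rising_recr exprSr ler_pM ?exprn_ge0 ?(ltW a0)// lerDl.
Qed.

Lemma rising_gt0 a n : 0 < a -> 0 < rising a n.
Proof. by move=> a0; apply: lt_le_trans (rising_ge _ _ a0); rewrite exprn_gt0. Qed.

Lemma Gamma_rising a n : 0 < a -> Gamma (n%:R + a) = rising a n * Gamma a.
Proof.
move=> a0; elim: n => [|n IH]; first by rewrite add0r /rising big_ord0 mul1r.
rewrite -natr1 addrAC GammaS ?IH ?rising_recr; last first.
  by rewrite ltr_wpDl.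
by rewrite [n%:R + a]addrC; ring.
Qed.

Definition bessel_coef a n : R := (-1) ^+ n / (n`!%:R * rising a n).

(** The hypergeometric function 0F1(; a; - y).  The variable y = (x/2)^2 is
used in place of x because the series has a nonzero term in every degree of y,
which suits the theory of power series. *)
Definition bessel_series a y : R := limn (pseries (bessel_coef a) y).

(** Comparison with the exponential series at |y| / a. *)
Lemma is_cvg_bessel_series a y : 0 < a -> cvgn (pseries (bessel_coef a) y).
Proof.
move=> a0; apply: normed_cvg.
apply: (@series_le_cvg _ _ (exp_coeff (`|y| / a))).
- by move=> n; rewrite normr_ge0.
- by move=> n; rewrite exp_coeff_ge0// divr_ge0// ltW.
- move=> n; rewrite /exp_coeff/= normrM normrX /bessel_coef normrM normrX normrN1.
  rewrite expr1n mul1r normfV [`|_ * rising a n|]gtr0_norm ?mulr_gt0 ?ltr0n ?fact_gt0 ?rising_gt0//.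
  rewrite expr_div_n [leLHS]mulrC invfM [leRHS]mulrAC -[leRHS]mulrA ler_wpM2l ?exprn_ge0//.
  rewrite ler_wpM2l ?invr_ge0// lef_pV2 ?posrE ?exprn_gt0 ?rising_gt0//.
  exact: rising_ge.
- exact: is_cvg_series_exp_coeff.
Qed.

(** Formal differentiation shifts the parameter, so the family of these series
is closed under it and every derivative converges everywhere. *)
Lemma bessel_diffs a : 0 < a -> pseries_diffs (bessel_coef a) =
  (fun n => - a^-1 * bessel_coef (a + 1) n).
Proof.
move=> a0; apply/funext => n; rewrite /pseries_diffs /bessel_coef.
rewrite factS natrM rising_recl exprS.
have h1 : n.+1%:R != 0 :> R by [].
have h2 : n`!%:R != 0 :> R by rewrite gt_eqF// ltr0n fact_gt0.
have h3 : rising (a + 1) n != 0 by rewrite gt_eqF// rising_gt0// addr_gt0.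
have h4 : a != 0 by rewrite gt_eqF.
by field; rewrite h2 h3 h4/= nat1r.
Qed.

Lemma pseriesZ k (c : R^nat) y :
  pseries (fun n => k * c n) y = k *: pseries c y.
Proof.
apply/funext => n.
change (\sum_(0 <= i < n) k * c i * y ^+ i = k * \sum_(0 <= i < n) c i * y ^+ i).
rewrite mulr_sumr.
by apply: eq_bigr => i _; rewrite mulrA.
Qed.

Lemma is_derive_bessel_series a y : 0 < a ->
  is_derive y (1 : R) (bessel_series a) (- a^-1 * bessel_series (a + 1) y).
Proof.
move=> a0; have a1 : 0 < a + 1 by rewrite addr_gt0.
have -> : - a^-1 * bessel_series (a + 1) y =
    limn (pseries (pseries_diffs (bessel_coef a)) y).
  rewrite bessel_diffs// pseriesZ; apply/esym/cvg_lim => //.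
  by apply: cvgZl_tmp; exact: is_cvg_bessel_series.
have D2 : pseries_diffs (pseries_diffs (bessel_coef a)) =
    (fun n => (- a^-1 * - (a + 1)^-1) * bessel_coef (a + 1 + 1) n).
  rewrite bessel_diffs//; apply/funext => n.
  have := congr1 (fun f => f n) (bessel_diffs _ a1).
  by rewrite /pseries_diffs => h; rewrite mulrCA h mulrA.
apply: (@pseries_snd_diffs _ _ (`|y| + 1)).
- exact: is_cvg_bessel_series.
- by rewrite bessel_diffs// pseriesZ; apply: is_cvgZl_tmp; exact: is_cvg_bessel_series.
- rewrite D2 pseriesZ; apply: is_cvgZl_tmp; apply: is_cvg_bessel_series.
  by rewrite addr_gt0.
- by rewrite [ltRHS]ger0_norm ?addr_ge0// ltrDl.
Qed.

Lemma continuous_bessel_series a : 0 < a -> continuous (bessel_series a).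
Proof.
move=> a0 y; apply: differentiable_continuous; apply/derivable1_diffP.
by have [] := is_derive_bessel_series _ y a0.
Qed.

Lemma bessel_coef_contig a n : 0 < a ->
  bessel_coef a n.+1 - bessel_coef (a + 1) n.+1 =
  - (a * (a + 1))^-1 * bessel_coef (a + 1 + 1) n.
Proof.
move=> a0; rewrite /bessel_coef.
have a1 : a + 1 != 0 by rewrite gt_eqF// addr_gt0.
have r2 : rising (a + 1 + 1) n = rising (a + 1) n * (a + 1 + n%:R) / (a + 1).
  by rewrite -rising_recr rising_recl mulrC mulKf.
rewrite r2 rising_recl rising_recr factS natrM exprS.
have h0 : a != 0 by rewrite gt_eqF.
have h1 : n.+1%:R != 0 :> R by [].
have h2 : n`!%:R != 0 :> R by rewrite gt_eqF// ltr0n fact_gt0.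
have h3 : rising (a + 1) n != 0 by rewrite gt_eqF// rising_gt0// addr_gt0.
have h4 : a + 1 + n%:R != 0 by rewrite gt_eqF// ltr_wpDr ?addr_gt0.
by rewrite -nat1r in h1 *; field; rewrite h0 h1 h2 h3 h4 a1.
Qed.

(** Since F' = - F_(a+1) / a and F'' = F_(a+2) / (a (a + 1)), this relation
is the Bessel equation y F'' + a F' + F = 0. *)
Lemma bessel_series_contig a y : 0 < a ->
  bessel_series a y - bessel_series (a + 1) y =
  - (a * (a + 1))^-1 * y * bessel_series (a + 1 + 1) y.
Proof.
move=> a0; have a1 : 0 < a + 1 by rewrite addr_gt0.
have a2 : 0 < a + 1 + 1 by rewrite addr_gt0.
have cv b : 0 < b -> pseries (bessel_coef b) y n @[n --> \oo] --> bessel_series b y.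
  by move=> b0; exact: is_cvg_bessel_series.
have cvS b : 0 < b -> pseries (bessel_coef b) y n.+1 @[n --> \oo] --> bessel_series b y.
  by move=> b0; rewrite (cvg_shiftS (pseries (bessel_coef b) y)); exact: cv.
have h1 := cvgB (cvS _ a0) (cvS _ a1).
have h2 : - (a * (a + 1))^-1 * y * pseries (bessel_coef (a + 1 + 1)) y n @[n --> \oo]
    --> - (a * (a + 1))^-1 * y * bessel_series (a + 1 + 1) y.
  by apply: cvgM; [exact: cvg_cst|exact: cv].
have e : (fun n => pseries (bessel_coef a) y n.+1 - pseries (bessel_coef (a + 1)) y n.+1)
    = (fun n => - (a * (a + 1))^-1 * y * pseries (bessel_coef (a + 1 + 1)) y n).
  apply/funext => n; rewrite /pseries /series/=.
  rewrite !big_nat_recl//= ![bessel_coef _ 0]/bessel_coef ![rising _ 0]big_ord0.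
  rewrite opprD addrACA subrr add0r -sumrB mulr_sumr; apply: eq_bigr => i _.
  by rewrite -mulrBl bessel_coef_contig// exprS; ring.
rewrite -e in h2.
exact: (cvg_unique _ (h1 _) h2).
Qed.

(** This is F^2 + y F'^2 for F = bessel_series a; at y = (x/2)^2 it equals
j_mu(x)^2 + j_mu'(x)^2 with mu = a - 1. *)
Definition bessel_energy a y : R :=
  bessel_series a y ^+ 2 + y * (a^-1 * bessel_series (a + 1) y) ^+ 2.

Lemma bessel_series0 a : bessel_series a 0 = 1.
Proof.
apply/cvg_lim => //; rewrite -(cvg_shiftS (pseries (bessel_coef a) 0)).
rewrite (_ : (fun n => _) = cst 1); first exact: cvg_cst.
apply/funext => n; rewrite /pseries /series/= big_nat_recl//= big1 => [|i _].
  by rewrite /bessel_coef /rising big_ord0 fact0 !expr0 !mulr1 divr1 addr0.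
by rewrite exprS mul0r mulr0.
Qed.

(** By the Bessel equation,
(F^2 + y F'^2)' = F' (2 F + F' + 2 y F'') = - (2 a - 1) F'^2. *)
Lemma is_derive_bessel_energy a y : 0 < a ->
  is_derive y (1 : R) (bessel_energy a)
    (- (2 * a - 1) * (a^-1 * bessel_series (a + 1) y) ^+ 2).
Proof.
move=> a0; have a1 : 0 < a + 1 by rewrite addr_gt0.
have D0 := is_derive_bessel_series _ y a0.
have D1 := is_derive_bessel_series _ y a1.
rewrite /bessel_energy; apply: is_derive_eq.
rewrite /GRing.scale/=.
have -> : bessel_series a y = bessel_series (a + 1) y +
    - (a * (a + 1))^-1 * y * bessel_series (a + 1 + 1) y.
  by rewrite -bessel_series_contig// subrKC.
by field; rewrite !gt_eqF.
Qed.

(** The condition a >= 1/2, that is mu >= -1/2, is what makes the energy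
nonincreasing. *)
Lemma bessel_energy_le1 a y : 2^-1 <= a -> 0 <= y -> bessel_energy a y <= 1.
Proof.
move=> a12 y0; have a0 : 0 < a by apply: lt_le_trans a12.
have -> : 1 = bessel_energy a 0 by rewrite /bessel_energy bessel_series0 mul0r addr0 expr1n.
have ce : {within `[0, y], continuous (bessel_energy a)}.
  apply: continuous_subspaceT => x.
  apply: differentiable_continuous; apply/derivable1_diffP.
  by have [] := is_derive_bessel_energy _ x a0.
have [c _ h] := MVT_segment y0 (fun c _ => is_derive_bessel_energy _ c a0) ce.
rewrite -subr_le0 h subr0.
by rewrite !mulNr oppr_le0 mulr_ge0 // mulr_ge0 ?sqr_ge0//; lra.
Qed.

Lemma dunkl_jE mu x : 0 < mu + 1 -> dunkl_j mu x = bessel_series (mu + 1) ((x / 2) ^+ 2).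
Proof.
move=> mu0; have G0 := Gamma_gt0 _ mu0.
rewrite /dunkl_j.
have -> : series (fun n =>
    (-1) ^+ n / (n`!%:R * Gamma (n%:R + mu + 1)) * (x / 2) ^+ (2 * n)) =
    pseries (fun n => (Gamma (mu + 1))^-1 * bessel_coef (mu + 1) n) ((x / 2) ^+ 2).
  apply/funext => n; apply: eq_bigr => i _.
  rewrite -addrA Gamma_rising// exprM /bessel_coef; congr (_ * _).
  by rewrite mulrA [in RHS]mulrCA -[in RHS]invfM [in RHS](mulrC (Gamma _)).
rewrite pseriesZ.
rewrite (_ : limn _ = (Gamma (mu + 1))^-1 * bessel_series (mu + 1) ((x / 2) ^+ 2)).
  by rewrite mulVKf ?gt_eqF.
apply/cvg_lim => //; apply: cvgZl_tmp; exact: is_cvg_bessel_series.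
Qed.

Lemma continuous_dunkl_j (mu : R) : 0 < mu + 1 -> continuous (dunkl_j mu).
Proof.
move=> mu0; rewrite (_ : dunkl_j mu = bessel_series (mu + 1) \o (fun x => (x / 2) ^+ 2)).
  move=> x; apply: continuous_comp; last exact: continuous_bessel_series.
  by apply: cvgM; apply: cvgM; (exact: cvg_id || exact: cvg_cst).
by apply/funext => x; rewrite dunkl_jE.
Qed.

Lemma dunkl_kernel_le1 (mu t : R) : - (1 / 2) <= mu ->
  dunkl_j mu t ^+ 2 + (t / (2 * (mu + 1)) * dunkl_j (mu + 1) t) ^+ 2 <= 1.
Proof.
move=> hmu; have mu0 : 0 < mu + 1 by lra.
have mu1 : 0 < mu + 1 + 1 by lra.
rewrite !dunkl_jE//.
have mu12 : 2^-1 <= mu + 1 by lra.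
apply: le_trans (bessel_energy_le1 _ _ mu12 (sqr_ge0 (t / 2))).
rewrite lerD2l le_eqVlt; apply/orP; left; apply/eqP.
by field; rewrite gt_eqF.
Qed.

End BesselSeries.

(** * The quaternion norm *)
Section Quaternions.
Context {R : realType}.
Implicit Types (p q : quat R) (x y t : R).

Lemma quat_normE q : `|q| = Num.sqrt (sqnormq q).
Proof. by []. Qed.

Lemma sqr_quat_norm q : `|q| ^+ 2 = sqnormq q.
Proof. by rewrite quat_normE sqr_sqrtr ?sqnormq_ge0. Qed.

Lemma sqnormqM p q : sqnormq (p * q) = sqnormq p * sqnormq q.
Proof. by rewrite !sqnormqE /=; ring. Qed.

Lemma quat_normM p q : `|p * q| = `|p| * `|q|.
Proof. by rewrite !quat_normE sqnormqM sqrtrM ?sqnormq_ge0. Qed.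

Lemma quat_norm1 : `|1 : quat R| = 1.
Proof. by rewrite quat_normE sqnormqE /= !expr0n/= !addr0 expr1n sqrtr1. Qed.

Lemma quat_normV q : `|q^-1| = `|q|^-1.
Proof.
have [->|q0] := eqVneq q 0; first by rewrite invr0 normr0 invr0.
have nq0 : `|q| != 0 by rewrite normr_eq0.
apply: (mulfI nq0); rewrite -quat_normM mulfV// divrr ?quat_norm1//.
Qed.

Lemma norm_component_le q : [/\ `|qre q| <= `|q|, `|qim_i q| <= `|q|,
  `|qim_j q| <= `|q| & `|qim_k q| <= `|q|].
Proof.
have h x : x ^+ 2 <= sqnormq q -> `|x| <= `|q|.
  by move=> hx; rewrite -sqrtr_sqr quat_normE ler_wsqrtr.
have := (sqr_ge0 (qre q), sqr_ge0 (qim_i q), sqr_ge0 (qim_j q), sqr_ge0 (qim_k q)).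
by move=> [[[h1 h2] h3] h4]; split; apply: h; rewrite sqnormqE; lra.
Qed.

Lemma quat_norm_le_sum q :
  `|q| <= `|qre q| + `|qim_i q| + `|qim_j q| + `|qim_k q|.
Proof.
have h0 : 0 <= `|qre q| + `|qim_i q| + `|qim_j q| + `|qim_k q| by rewrite !addr_ge0.
rewrite quat_normE -[leRHS]ger0_norm// -sqrtr_sqr ler_wsqrtr// sqnormqE.
rewrite -(real_normK (num_real (qre q))) -(real_normK (num_real (qim_i q))).
rewrite -(real_normK (num_real (qim_j q))) -(real_normK (num_real (qim_k q))).
move: `|qre q| `|qim_i q| `|qim_j q| `|qim_k q| (normr_ge0 (qre q))
 (normr_ge0 (qim_i q)) (normr_ge0 (qim_j q)) (normr_ge0 (qim_k q)) => a b c d *.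
nra.
Qed.

End Quaternions.

(** * Componentwise regularity of quaternion-valued functions *)

(** Regularity is expressed on the four real components because the integral
of a quaternion-valued function is itself defined component by component. *)
Definition qcomp {T : Type} {R : realType} (P : (T -> R) -> Prop)
    (F : T -> quat R) : Prop :=
  [/\ P (fun v => qre (F v)), P (fun v => qim_i (F v)),
      P (fun v => qim_j (F v)) & P (fun v => qim_k (F v))].

(** The closure properties common to measurable functions and to continuous
functions.  The kernels must be measurable in v and continuous in w; both facts
follow from one sequence of lemmas about such a class. *)
Definition function_algebra {T : Type} {R : realType} (P : (T -> R) -> Prop) : Prop :=
  [/\ forall c, P (fun=> c),
      forall f g, P f -> P g -> P (fun v => f v + g v),
      forall f g, P f -> P g -> P (fun v => f v * g v) &
      forall (phi : R -> R) f, continuous phi -> P f -> P (fun v => phi (f v))].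

Lemma function_algebra_measurable {R : realType} {d} {T : measurableType d} :
  function_algebra (fun f : T -> R => measurable_fun [set: T] f).
Proof.
split => [c|f g|f g|phi f]; [|exact: measurable_funD|exact: measurable_funM|].
- exact: measurable_cst.
- by move=> /continuous_measurable_fun mphi mf; exact: measurableT_comp mphi mf.
Qed.

Lemma function_algebra_continuous {R : realType} {T : topologicalType} :
  function_algebra (fun f : T -> R => continuous f).
Proof.
split => [c|f g cf cg|f g cf cg|phi f cphi cf] x.
- exact: cvg_cst.
- by apply: cvgD; [exact: cf|exact: cg].
- by apply: cvgM; [exact: cf|exact: cg].
- by apply: continuous_comp; [exact: cf|exact: cphi].
Qed.

Section QuaternionClosure.
Context {T : Type} {R : realType} (P : (T -> R) -> Prop).
Hypothesis PA : function_algebra P.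

Let Pc c : P (fun=> c). Proof. by have [] := PA. Qed.

Let PD f g : P f -> P g -> P (fun v => f v + g v).
Proof. by have [_ h _ _] := PA; exact: h. Qed.

Let PM f g : P f -> P g -> P (fun v => f v * g v).
Proof. by have [_ _ h _] := PA; exact: h. Qed.

Let Pcomp (phi : R -> R) f : continuous phi -> P f -> P (fun v => phi (f v)).
Proof. by have [_ _ _ h] := PA; exact: h. Qed.

Let PN f : P f -> P (fun v => - f v).
Proof. by apply: Pcomp; exact: opp_continuous. Qed.

Lemma qcomp_cst q : qcomp P (fun=> q).
Proof. by split. Qed.

Lemma qcompD F G : qcomp P F -> qcomp P G -> qcomp P (fun v => F v + G v).
Proof. by move=> [F1 F2 F3 F4] [G1 G2 G3 G4]; split => /=; exact: PD. Qed.

Lemma qcompZ f F : P f -> qcomp P F -> qcomp P (fun v => f v *: F v).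
Proof. by move=> Pf [F1 F2 F3 F4]; split => /=; exact: PM. Qed.

Lemma qcompM F G : qcomp P F -> qcomp P G -> qcomp P (fun v => F v * G v).
Proof.
move=> [F1 F2 F3 F4] [G1 G2 G3 G4]; split => /=;
  repeat first [exact: PM | apply: PD | apply: PN].
Qed.

Lemma qcomp_expq q f : P f -> qcomp P (fun v => expq q (f v)).
Proof.
move=> Pf; apply: qcompD; apply: qcompZ; try exact: qcomp_cst.
- by apply: Pcomp => //; exact: continuous_cos.
- by apply: Pcomp => //; exact: continuous_sin.
Qed.

Lemma qcomp_chirp q k l f : P f ->
  qcomp P (fun v => expq q (- (k * f v ^+ 2 + l * f v))).
Proof.
by move=> Pf; apply: qcomp_expq; apply: PN;
  repeat first [exact: PM | apply: PD | apply: PM].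
Qed.

Section DunklKernel.
Variables (mu : R) (mu_gt0 : 0 < mu + 1).

Lemma qcomp_dunkl_E q f g : P f -> P g ->
  qcomp P (fun v => dunkl_E mu q (f v) (g v)).
Proof.
move=> Pf Pg; have Pfg := PM _ _ Pf Pg.
have cj := continuous_dunkl_j _ mu_gt0.
have cj1 : continuous (dunkl_j (mu + 1)) by apply: continuous_dunkl_j; rewrite addr_gt0.
apply: qcompD; apply: qcompZ; try exact: qcomp_cst.
- exact: Pcomp cj Pfg.
- by apply: PM; [exact: PM|exact: Pcomp cj1 Pfg].
Qed.

Lemma qcomp_qpd_kernel q a b c d e f g : P f -> P g ->
  qcomp P (fun v => qpd_kernel mu q a b c d e (f v) (g v)).
Proof.
move=> Pf Pg; apply: qcompM; [apply: qcompM; last exact: qcomp_cst|].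
- by apply: qcomp_dunkl_E => //; apply: PN; exact: PM.
- by apply: qcomp_expq; apply: PN; repeat first [exact: PM | apply: PD | apply: PM].
Qed.

End DunklKernel.
End QuaternionClosure.

(** * Topology and Borel sets of the quaternions *)
Section QuatTopology.
Context {R : realType}.

Lemma continuous_qcomp {T : topologicalType} (F : T -> quat R) :
  qcomp (fun f => continuous f) F -> continuous F.
Proof.
move=> [F1 F2 F3 F4] w; apply/cvgrPdist_lt => e e0.
have e4 : 0 < e / 4 by rewrite divr_gt0.
near=> z.
apply: le_lt_trans (quat_norm_le_sum _) _ => /=.
have h1 : `|qre (F w) - qre (F z)| < e / 4.
  by near: z; move/cvgrPdist_lt : (F1 w); apply.
have h2 : `|qim_i (F w) - qim_i (F z)| < e / 4.
  by near: z; move/cvgrPdist_lt : (F2 w); apply.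
have h3 : `|qim_j (F w) - qim_j (F z)| < e / 4.
  by near: z; move/cvgrPdist_lt : (F3 w); apply.
have h4 : `|qim_k (F w) - qim_k (F z)| < e / 4.
  by near: z; move/cvgrPdist_lt : (F4 w); apply.
rewrite -!addrA. lra.
Unshelve. all: end_near. Qed.

Lemma continuous_contraction (f : quat R -> R) :
  (forall p q, f (p - q) = f p - f q) -> (forall q, `|f q| <= `|q|) -> continuous f.
Proof.
move=> fB f1 q; apply/(@cvgrPdist_lt _ _ _ _ (nbhs_filter q)) => e e0; apply/nbhs_normP.
by exists e => //= z; rewrite -fB; apply: le_lt_trans (f1 _).
Qed.

Lemma qcomp_continuous_id : qcomp (fun f => continuous f) (@id (quat R)).
Proof.
by split; apply: continuous_contraction => // q; have [] := norm_component_le q.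
Qed.

Lemma qcomp_continuous {T : topologicalType} (F : T -> quat R) :
  continuous F -> qcomp (fun f => continuous f) F.
Proof.
by move=> cF; have [h1 h2 h3 h4] := qcomp_continuous_id; split => w;
  (apply: continuous_comp; [exact: cF|]); [exact: h1|exact: h2|exact: h3|exact: h4].
Qed.

Lemma qcomp_borel {d} {T : measurableType d} (F : T -> quat R) :
  measurable_fun [set: T] (F : _ -> g_sigma_algebraType (@open (quat R))) ->
  qcomp (measurable_fun [set: T]) F.
Proof.
have h (f : quat R -> R) : continuous f ->
    measurable_fun [set: g_sigma_algebraType (@open (quat R))] f.
  move=> /continuousP cf; apply: (measurability _ (RGenOpens.measurableE R)).
  move=> _ [_ [a [b ->] <-]]; rewrite setTI; apply: sub_sigma_algebra.
  exact/cf/interval_open.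
move=> mF; have [h1 h2 h3 h4] := qcomp_continuous_id; split.
- exact: (measurableT_comp (h _ h1)).
- exact: (measurableT_comp (h _ h2)).
- exact: (measurableT_comp (h _ h3)).
- exact: (measurableT_comp (h _ h4)).
Qed.

End QuatTopology.

(** * Continuity of parameter integrals *)
Section DominatedContinuity.
Context {R : realType}.

(** Dominated convergence is a statement about sequences.  If f were not
continuous at p, points at distance less than 1 / (n + 1) from p whose values
stay away from f p would form a sequence contradicting the hypothesis. *)
Lemma continuous_seq {V : pseudoMetricType R} (f : V -> R) (p : V) :
  (forall u : nat -> V, u n @[n --> \oo] --> p -> f (u n) @[n --> \oo] --> f p) ->
  {for p, continuous f}.
Proof.
move=> hseq; apply/cvgrPdist_lt => e e0; apply/not_notP => hn.
have ex n : exists x, ball p n.+1%:R^-1 x /\ e <= `|f p - f x|.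
  apply/not_existsP => h; apply: hn; apply/nbhs_ballP.
  exists n.+1%:R^-1 => /=; first by rewrite invr_gt0.
  move=> x px; rewrite ltNge; apply/negP => ex; exact: (h x).
have [u hu] := choice ex.
have up : u n @[n --> \oo] --> p.
  apply/cvg_ballP => r r0; near=> n.
  have := (hu n).1; apply: le_ball.
  near: n; have := @cvgr_dist_lt _ _ _ _ _ _ _ (@cvg_harmonic R) r r0.
  move=> [N _ hN]; exists N => // n Nn; have := hN n Nn.
  by rewrite /= sub0r normrN ger0_norm ?invr_ge0// => /ltW.
have /cvgrPdist_lt /(_ e e0) [N _ /(_ N (leqnn _))] := hseq u up.
by rewrite ltNge (hu N).2.
Unshelve. all: end_near. Qed.

Lemma continuous_Rintegral {V : pseudoMetricType R} {d} {Y : measurableType d}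
    (nu : {measure set Y -> \bar R}) (F : V -> Y -> R) (g : Y -> R) :
  (forall w, measurable_fun [set: Y] (F w)) ->
  nu.-integrable [set: Y] (EFin \o g) ->
  (forall w y, `|F w y| <= g y) ->
  (forall y, continuous (F ^~ y)) ->
  continuous (fun w => \int[nu]_y F w y).
Proof.
move=> mF ig Fg cF p; apply: continuous_seq => u up.
have intF w : nu.-integrable [set: Y] (EFin \o F w).
  apply: le_integrable ig => //; first exact/measurable_EFinP.
  by move=> y _; rewrite /= lee_fin (le_trans (Fg w y))// ler_norm.
apply: fine_cvg; rewrite fineK; last by apply: integrable_fin_num => //; exact: intF.
apply: (@dominated_cvg _ _ _ nu _ _ (fun n y => (F (u n) y)%:E) _ (EFin \o g)) => //.
- by move=> n; exact/measurable_EFinP.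
- move=> y _; apply: cvg_EFin; first exact: nearW.
  exact: (cvg_comp _ _ up (cF y p)).
- by move=> n y _; rewrite /= lee_fin.
Qed.

End DominatedContinuity.

(** * Borel sets of the plane *)
Section PlaneMeasurability.
Context {R : realType}.

(** An open set is the union of the squares with rational centre and rational
half-side that it contains, and these are countably many. *)
Lemma open_measurable_plane (U : set (R * R)) : open U -> measurable U.
Proof.
move=> oU.
pose Q (i : rat * rat * rat) : set (R * R) :=
  `]ratr i.1.1 - ratr i.2, ratr i.1.1 + ratr i.2[%classic `*`
  `]ratr i.1.2 - ratr i.2, ratr i.1.2 + ratr i.2[%classic.
have -> : U = \bigcup_(i in [set i | Q i `<=` U]) Q i.
  apply/seteqP; split => [v Uv|v [i /= QU Qv]]; last exact: QU.
  have := open_nbhs_nbhs (conj oU Uv) => /nbhs_ballP[e /= e0 eU].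
  have e3 : e / 4 < e / 2 by lra.
  (* a square of half-side r whose centre is within r of v lies within 2 r < e
     of v *)
  have [r] := rat_in_itvoo e3; rewrite in_itv/= => /andP[r1 r2].
  have r0 : 0 < ratr r :> R by lra.
  have hq (x : R) : exists q : rat, `|x - ratr q| < ratr r.
    have h : x - ratr r < x + ratr r by lra.
    have [q] := rat_in_itvoo h; rewrite in_itv/= => /andP[q1 q2]; exists q.
    by rewrite ltr_norml; apply/andP; split; lra.
  have [q1 h1] := hq v.1; have [q2 h2] := hq v.2.
  exists (q1, q2, r) => /=.
    move=> [x y]; rewrite /Q/= !in_itv/= => -[/andP[a1 b1] /andP[a2 b2]].
    apply: eU; move: h1 h2; rewrite !ltr_norml => /andP[c1 d1] /andP[c2 d2].
    by split; rewrite /ball/= ltr_norml; apply/andP; split; lra.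
  move: h1 h2; rewrite !ltr_norml => /andP[c1 d1] /andP[c2 d2].
  by rewrite /Q/= !in_itv/=; split; apply/andP; split; lra.
rewrite bigcup_mkcond; apply: countable_bigcupT_measurable => // i.
by case: ifPn => // _; apply: measurableX; exact: measurable_itv.
Qed.

Lemma continuous_measurable_plane (f : R * R -> R) :
  continuous f -> measurable_fun [set: R * R] f.
Proof.
move=> /continuousP cf; apply: (measurability _ (RGenOpens.measurableE R)).
move=> _ [_ [a [b ->] <-]]; rewrite setTI; apply: open_measurable_plane.
exact/cf/interval_open.
Qed.

End PlaneMeasurability.

(** * Measures given by a density *)
Section Density.
Context d {T : measurableType d} {R : realType}.
Variables (lam : {measure set T -> \bar R}) (w : T -> R).
Hypothesis w0 : forall x, 0 <= w x.
Hypothesis mw : measurable_fun [set: T] w.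
Local Open Scope ereal_scope.

Definition density_measure (A : set T) : \bar R := \int[lam]_(x in A) (w x)%:E.

Local Notation nu := density_measure.

Let density_measure0 : nu set0 = 0.
Proof. exact: integral_set0. Qed.

Let density_measure_ge0 A : 0 <= nu A.
Proof. by apply: integral_ge0 => x _; rewrite lee_fin. Qed.

Let density_measure_sigma_additive : semi_sigma_additive nu.
Proof.
move=> /= A mA tA mUA; rewrite /density_measure ge0_integral_bigcup//.
- by apply: is_cvg_ereal_nneg_natsum_cond => n _ _; exact: density_measure_ge0.
- by apply: measurable_funTS; exact/measurable_EFinP.
- by move=> x _; rewrite lee_fin.
Qed.

HB.instance Definition _ := isMeasure.Build _ _ _ density_measure
  density_measure0 density_measure_ge0 density_measure_sigma_additive.

Definition measure_of_density : {measure set T -> \bar R} := density_measure.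

Import HBNNSimple.

Let mew : measurable_fun [set: T] (fun x => (w x)%:E).
Proof. exact/measurable_EFinP. Qed.

Let integral_density_nnsfun (h : {nnsfun T >-> R}) :
  \int[nu]_x (h x)%:E = \int[lam]_x ((h x)%:E * (w x)%:E).
Proof.
under [LHS]eq_integral do rewrite fimfunE -fsumEFin//.
rewrite [LHS]ge0_integral_fsum//; last 2 first.
  - by move=> r; exact/measurable_EFinP/measurableT_comp.
  - by move=> n x _; rewrite EFinM nnfun_muleindic_ge0.
under [RHS]eq_integral.
  move=> x xD; rewrite fimfunE -fsumEFin// muleC ge0_mule_fsumr; last first.
    by move=> r; rewrite EFinM nnfun_muleindic_ge0.
  over.
rewrite [RHS]ge0_integral_fsum//; last 2 first.
  - move=> r; apply: emeasurable_funM => //.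
    exact/measurable_EFinP/measurableT_comp.
  - move=> n x _; rewrite EFinM mule_ge0//; first by rewrite lee_fin.
    by rewrite nnfun_muleindic_ge0.
apply: eq_fsbigr => r _.
rewrite integralZl_indic_nnsfun//= integral_indic//= setIT.
have mA : measurable (h @^-1` [set r]) by exact: measurable_funPTI.
(* a negative r is not a value of h: both sides vanish *)
have [r0|r0] := leP 0%R r; last first.
  rewrite preimage_nnfun0// measure0 mule0 integral0_eq// => x _.
  by rewrite indic0 mulr0 mule0.
under [RHS]eq_integral => x _ do rewrite EFinM muleCA.
rewrite ge0_integralZl_EFin//.
- rewrite [density_measure _]integral_mkcond; congr (_ * _).
  apply: eq_integral => x _; rewrite patchE indicE.
  by case: ifPn => _; rewrite ?mule1 ?mule0.
- by move=> x _; rewrite mule_ge0// lee_fin.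
- by apply: emeasurable_funM => //; exact/measurable_EFinP.
Qed.

(** The formula holds for simple functions by additivity and passes to
nonnegative functions by monotone convergence on both sides. *)
Lemma ge0_integral_density (f : T -> \bar R) :
  measurable_fun [set: T] f -> (forall x, 0 <= f x) ->
  \int[measure_of_density]_x f x = \int[lam]_x (f x * (w x)%:E).
Proof.
move=> mf f0; rewrite /measure_of_density/=; pose h := nnsfun_approx measurableT mf.
have cvh x : (h n x)%:E @[n --> \oo] --> f x by exact: cvg_nnsfun_approx.
have nd x : nondecreasing_seq (fun n => h n x).
  by move=> m n mn; exact/lefP/nd_nnsfun_approx.
transitivity (limn (fun n => \int[nu]_x (h n x)%:E)).
  rewrite -monotone_convergence//=.
  - by apply: eq_integral => x _; apply/esym/cvg_lim.
  - by move=> n; exact/measurable_EFinP.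
  - by move=> n x _; rewrite lee_fin.
  - by move=> x _ m n mn; rewrite lee_fin; exact: nd.
under eq_fun do rewrite integral_density_nnsfun.
rewrite -monotone_convergence//=.
- apply: eq_integral => x _; apply/cvg_lim => //.
  by apply: cvgeZr.
- by move=> n; apply: emeasurable_funM => //; exact/measurable_EFinP.
- by move=> n x _; rewrite mule_ge0// lee_fin.
- by move=> x _ m n mn; rewrite lee_wpmul2r ?lee_fin//; exact: nd.
Qed.

End Density.

(** * Algebra and size of the kernels *)
Section KernelAlgebra.
Context {R : realType} (q : quat R).
Hypotheses (q0 : qre q = 0) (q1 : sqnormq q = 1).
Implicit Types x y s t : R.

(** For an imaginary unit q the norm on R + q R is the complex modulus. *)
Lemma sqnormq_complex x y : sqnormq (x%:A + y *: q) = x ^+ 2 + y ^+ 2.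
Proof.
move: q1; rewrite !sqnormqE /= q0 => h.
have -> : y ^+ 2 = y ^+ 2 * (0 ^+ 2 + qim_i q ^+ 2 + qim_j q ^+ 2 + qim_k q ^+ 2).
  by rewrite h mulr1.
by ring.
Qed.

(** Factors along the same imaginary unit can be permuted.  Factors along i and
along j cannot, which is why the two kernels stay on their own sides of f. *)
Lemma commq_complex x y x' y' : GRing.comm (x%:A + y *: q) (x'%:A + y' *: q).
Proof. by rewrite /GRing.comm; apply: quatP => /=; ring. Qed.

Lemma expqD s t : expq q (s + t) = expq q s * expq q t.
Proof.
rewrite /expq cosD sinD.
move: q1; rewrite sqnormqE q0 expr0n add0r /= => h.
apply: quatP => /=; rewrite q0; [|by ring..].
by rewrite !mulr0 !mulr1 !addr0 !add0r -[in LHS](mulr1 (sin s * sin t)) -h; ring.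
Qed.

Lemma normq_expq t : `|expq q t| = 1.
Proof. by rewrite quat_normE sqnormq_complex cos2Dsin2 sqrtr1. Qed.

Lemma normq_powq t s : `|powq q t s| = `|t| `^ s.
Proof. by rewrite normrZ normq_expq mulr1 ger0_norm ?powR_ge0. Qed.

Lemma normq_dunkl_E mu x y : - (1 / 2) <= mu -> `|dunkl_E mu q x y| <= 1.
Proof.
move=> hmu; rewrite quat_normE sqnormq_complex -[leRHS]sqrtr1 ler_wsqrtr//.
exact: dunkl_kernel_le1.
Qed.

Lemma normq_qpd_kernel mu a b c d e w v : - (1 / 2) <= mu ->
  `|qpd_kernel mu q a b c d e w v| <= (`|b| `^ (mu + 1))^-1.
Proof.
move=> hmu; rewrite /qpd_kernel !quat_normM quat_normV normq_powq normq_expq mulr1.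
by rewrite ler_piMl ?invr_ge0 ?powR_ge0// normq_dunkl_E.
Qed.

(** The factor independent of v stands first: this is the form of the kernel on
the left of f, whose outer end is its left end. *)
Lemma qpd_kernelEl mu a b c d e w v :
  qpd_kernel mu q a b c d e w v =
  (expq q (- (c * w ^+ 2 + e * w)) / powq q b (mu + 1)) *
  (dunkl_E mu q (- (w / b)) v * expq q (- (a * v ^+ 2 + d * v))).
Proof.
rewrite /qpd_kernel.
have -> : - (a * v ^+ 2 + c * w ^+ 2 + d * v + e * w) =
  - (c * w ^+ 2 + e * w) + - (a * v ^+ 2 + d * v) by ring.
rewrite expqD; set P := powq q b (mu + 1); set X := expq q (- (c * _ + _)).
set Y := expq q _; set E := dunkl_E _ _ _ _.
have cEX : GRing.comm E X by exact: commq_complex.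
have cEP : GRing.comm E P^-1.
  apply: commrV; rewrite /P /powq /expq scalerDr !scalerA.
  exact: commq_complex.
have cXP : GRing.comm X P^-1.
  apply: commrV; rewrite /P /powq /expq scalerDr !scalerA.
  exact: commq_complex.
by rewrite cEP !mulrA cXP -[P^-1 * E * X]mulrA cEX mulrA.
Qed.

(** The factor independent of v stands last, for the kernel on the right of f. *)
Lemma qpd_kernelEr mu a b c d e w v :
  qpd_kernel mu q a b c d e w v =
  (expq q (- (a * v ^+ 2 + d * v)) * dunkl_E mu q (- (w / b)) v) *
  (expq q (- (c * w ^+ 2 + e * w)) / powq q b (mu + 1)).
Proof.
rewrite qpd_kernelEl; set P := powq q b (mu + 1); set X := expq q (- (c * _ + _)).
set Y := expq q _; set E := dunkl_E _ _ _ _.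
have cEY : GRing.comm E Y by exact: commq_complex.
rewrite cEY; symmetry; apply: (_ : GRing.comm (Y * E) (X / P)).
have cP z : GRing.comm z P -> GRing.comm z P^-1 by exact: commrV.
have hP x y : GRing.comm (x%:A + y *: q) P.
  by rewrite /P /powq /expq scalerDr !scalerA; exact: commq_complex.
apply: commrM; apply: commr_sym; apply: commrM.
- exact: commq_complex.
- exact: commq_complex.
- by apply: commr_sym; apply: cP; exact: hP.
- by apply: commr_sym; apply: cP; exact: hP.
Qed.

End KernelAlgebra.

(** * Quaternion-valued integrals *)
Section QIntegral.
Context {R : realType}.
Variable mu : R.
Implicit Types (F G : R * R -> quat R) (p q : quat R).
Notation nu := (dunkl_measure mu).

(** A form of integrability that Borel measurable integrable functions and
Schwartz functions both reach directly, the latter through the continuity of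
their components. *)
Definition qL1 F : Prop :=
  qcomp (fun h => measurable_fun [set: R * R] h) F /\ (dunkl_norm1 mu F < +oo)%E.

Definition qintegrable F : Prop :=
  qcomp (fun g => nu.-integrable [set: R * R] (EFin \o g)) F.

Lemma measurable_quat_norm {d} {T : measurableType d} (F : T -> quat R) :
  qcomp (fun h => measurable_fun [set: T] h) F -> measurable_fun [set: T] (fun v => `|F v|).
Proof.
move=> [F1 F2 F3 F4].
rewrite (_ : (fun v => _) = Num.sqrt \o (fun v => qre (F v) ^+ 2 + qim_i (F v) ^+ 2 +
    qim_j (F v) ^+ 2 + qim_k (F v) ^+ 2)); last first.
  by apply/funext => v; rewrite quat_normE sqnormqE.
apply: measurableT_comp; first by apply: continuous_measurable_fun; exact: sqrt_continuous.
by do 3 ?[apply: measurable_funD]; exact: measurable_funX.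
Qed.

Lemma qL1_norm_integrable F : qL1 F ->
  nu.-integrable [set: R * R] (fun v => (`|F v|)%:E).
Proof.
move=> [mF F1]; apply/integrableP; split.
  by apply/measurable_EFinP; exact: measurable_quat_norm.
by under eq_integral do rewrite /= normr_id.
Qed.

Lemma qL1_dominated F G C : qL1 F -> qcomp (fun h => measurable_fun [set: R * R] h) G ->
  (forall v, `|G v| <= C * `|F v|) -> qL1 G.
Proof.
move=> F1 mG GF; split => //.
have := integrableZl measurableT C (qL1_norm_integrable _ F1).
move=> /integrableP[mCF]; apply: le_lt_trans.
apply: ge0_le_integral => //=.
- by apply/measurable_EFinP; exact: measurable_quat_norm.
- apply/measurable_EFinP; apply: measurableT_comp => //.
  by apply: measurable_funM => //; exact: measurable_quat_norm F1.1.
- move=> v _; rewrite lee_fin.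
  exact: le_trans (GF v) (ler_norm _).
Qed.

Lemma qL1_integrable F : qL1 F -> qintegrable F.
Proof.
move=> F1; have [[m1 m2 m3 m4] _] := F1.
have iF := qL1_norm_integrable _ F1.
by split; apply: (le_integrable measurableT _ _ iF);
  [exact/measurable_EFinP| |exact/measurable_EFinP| |exact/measurable_EFinP| |
   exact/measurable_EFinP| ]; move=> v _; rewrite /= normr_id lee_fin;
  have [] := norm_component_le (F v).
Qed.

Let intZ a (f : R * R -> R) : nu.-integrable setT (EFin \o f) ->
  nu.-integrable setT (EFin \o (fun v => a * f v)).
Proof. by move=> fi; have := integrableZl measurableT a fi. Qed.

Let intD (f g : R * R -> R) : nu.-integrable setT (EFin \o f) ->
  nu.-integrable setT (EFin \o g) -> nu.-integrable setT (EFin \o (fun v => f v + g v)).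
Proof. by move=> fi gi; have := integrableD measurableT fi gi. Qed.

Lemma Rintegral_lincomb4 (f1 f2 f3 f4 : R * R -> R) (a1 a2 a3 a4 : R) :
  nu.-integrable setT (EFin \o f1) -> nu.-integrable setT (EFin \o f2) ->
  nu.-integrable setT (EFin \o f3) -> nu.-integrable setT (EFin \o f4) ->
  \int[nu]_v (a1 * f1 v + a2 * f2 v + a3 * f3 v + a4 * f4 v) =
  a1 * (\int[nu]_v f1 v) + a2 * (\int[nu]_v f2 v) + a3 * (\int[nu]_v f3 v)
  + a4 * (\int[nu]_v f4 v).
Proof.
move=> i1 i2 i3 i4.
rewrite RintegralD//; [|by apply: intD; [apply: intD|]; exact: intZ|exact: intZ].
rewrite RintegralD//; [|by apply: intD; exact: intZ|exact: intZ].
rewrite RintegralD//; [|exact: intZ|exact: intZ].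
by rewrite !RintegralZl.
Qed.

Lemma qintegralMl p F : qintegrable F ->
  qintegral mu (fun v => p * F v) = p * qintegral mu F.
Proof.
move=> [i1 i2 i3 i4]; apply: quatP => /=.
- transitivity (\int[nu]_v (qre p * qre (F v) + (- qim_i p) * qim_i (F v)
    + (- qim_j p) * qim_j (F v) + (- qim_k p) * qim_k (F v))).
    by apply: eq_Rintegral => v _; ring.
  by rewrite Rintegral_lincomb4//; ring.
- transitivity (\int[nu]_v (qim_i p * qre (F v) + qre p * qim_i (F v)
    + (- qim_k p) * qim_j (F v) + qim_j p * qim_k (F v))).
    by apply: eq_Rintegral => v _; ring.
  by rewrite Rintegral_lincomb4//; ring.
- transitivity (\int[nu]_v (qim_j p * qre (F v) + qim_k p * qim_i (F v)
    + qre p * qim_j (F v) + (- qim_i p) * qim_k (F v))).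
    by apply: eq_Rintegral => v _; ring.
  by rewrite Rintegral_lincomb4//; ring.
- transitivity (\int[nu]_v (qim_k p * qre (F v) + (- qim_j p) * qim_i (F v)
    + qim_i p * qim_j (F v) + qre p * qim_k (F v))).
    by apply: eq_Rintegral => v _; ring.
  by rewrite Rintegral_lincomb4//; ring.
Qed.

Lemma qintegralMr p F : qintegrable F ->
  qintegral mu (fun v => F v * p) = qintegral mu F * p.
Proof.
move=> [i1 i2 i3 i4]; apply: quatP => /=.
- transitivity (\int[nu]_v (qre p * qre (F v) + (- qim_i p) * qim_i (F v)
    + (- qim_j p) * qim_j (F v) + (- qim_k p) * qim_k (F v))).
    by apply: eq_Rintegral => v _; ring.
  by rewrite Rintegral_lincomb4//; ring.
- transitivity (\int[nu]_v (qim_i p * qre (F v) + qre p * qim_i (F v)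
    + qim_k p * qim_j (F v) + (- qim_j p) * qim_k (F v))).
    by apply: eq_Rintegral => v _; ring.
  by rewrite Rintegral_lincomb4//; ring.
- transitivity (\int[nu]_v (qim_j p * qre (F v) + (- qim_k p) * qim_i (F v)
    + qre p * qim_j (F v) + qim_i p * qim_k (F v))).
    by apply: eq_Rintegral => v _; ring.
  by rewrite Rintegral_lincomb4//; ring.
- transitivity (\int[nu]_v (qim_k p * qre (F v) + qim_j p * qim_i (F v)
    + (- qim_i p) * qim_j (F v) + qre p * qim_k (F v))).
    by apply: eq_Rintegral => v _; ring.
  by rewrite Rintegral_lincomb4//; ring.
Qed.

(** With q the integral of F, |q|^2 is the integral of the scalar product of q
with F, which is pointwise at most |q| |F|; dividing by |q| gives the constant
1, where an estimate of each component would lose a factor. *)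
Lemma qintegral_norm_le F : qL1 F ->
  ((`|qintegral mu F|)%:E <= dunkl_norm1 mu F)%E.
Proof.
move=> F1; have iF := qL1_norm_integrable _ F1.
have [i1 i2 i3 i4] := qL1_integrable _ F1.
have -> : dunkl_norm1 mu F = (\int[nu]_v `|F v|)%:E.
  by rewrite fineK//; exact: integrable_fin_num.
rewrite lee_fin; set q := qintegral mu F.
have [q0|q0] := eqVneq `|q| 0; first by rewrite q0 Rintegral_ge0.
have qgt0 : 0 < `|q| by rewrite lt0r q0 normr_ge0.
rewrite -(ler_pM2l qgt0) -expr2 sqr_quat_norm sqnormqE.
have -> : qre q ^+ 2 + qim_i q ^+ 2 + qim_j q ^+ 2 + qim_k q ^+ 2 =
  \int[nu]_v (qre q * qre (F v) + qim_i q * qim_i (F v)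
    + qim_j q * qim_j (F v) + qim_k q * qim_k (F v)).
  by rewrite Rintegral_lincomb4.
rewrite -RintegralZl//.
apply: le_Rintegral => //.
- by apply: intD; [apply: intD; [apply: intD|]|]; exact: intZ.
- by have := integrableZl measurableT `|q| iF.
- move=> v _. rewrite -quat_normM.
  (* the scalar product is the real part of conjq q * F v *)
  have -> : `|q * F v| = `|conjq q * F v|.
    rewrite !quat_normM; congr (_ * _); rewrite !quat_normE; congr Num.sqrt.
    by rewrite !sqnormqE /= !sqrrN.
  have [h _ _ _] := norm_component_le (conjq q * F v).
  apply: le_trans h; apply: le_trans (ler_norm _).
  by rewrite le_eqVlt /=; apply/orP; left; apply/eqP; ring.
Qed.

End QIntegral.

(** * Integrability of Schwartz functions *)
Section Schwartz.
Context {R : realType}.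
Implicit Types (x s : R) (f : R * R -> quat R).

Let oneDsqr_gt0 x : 0 < oneDsqr x.
Proof. exact: lt_le_trans ltr01 (oneDsqr_ge1 x). Qed.

Let oneDsqr_ge0 x : 0 <= oneDsqr x.
Proof. exact/ltW. Qed.

(** Two of the factors 1 + |x| absorb 1 + x^2, the others absorb |x|^s. *)
Lemma powR_decay s : 0 <= s ->
  exists n : nat, forall x, `|x| `^ s <= (1 + `|x|) ^+ n * (oneDsqr x)^-1.
Proof.
move=> s0; exists (Num.truncn s).+3 => x.
have x0 : 0 <= `|x| by [].
rewrite ler_pdivlMr; last by rewrite oneDsqr_gt0.
rewrite -[(Num.truncn s).+3]addn2 exprD ler_pM ?powR_ge0 ?oneDsqr_ge0//.
- apply: (@le_trans _ _ ((1 + `|x|) `^ s)).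
    by apply: ge0_ler_powR; rewrite ?nnegrE ?addr_ge0// lerDr.
  rewrite -powR_mulrn ?addr_ge0//; apply: ler_powR; first by rewrite lerDl.
  by apply: ltW; exact: truncnS_gt.
- by rewrite /oneDsqr -(real_normK (num_real x)) sqrrD expr1n; nra.
Qed.

Lemma integral_oneDsqr_lty :
  (\int[lebesgue_measure]_x (oneDsqr x)^-1%:E < +oo :> \bar R)%E.
Proof.
rewrite ge0_symfun_integralT//=.
- by rewrite -set_itvcy integral0y_oneDsqr -EFinM ltry.
- exact: continuous_oneDsqrV.
- by move=> x; rewrite /= /oneDsqr sqrrN.
Qed.

(** The Dunkl measure is built on the measurable structure of R * R, its density
formula on that of the domain of Lebesgue measure.  Both structures have the
same measurable sets, so the identity is measurable from one to the other and
transports the integral as a pushforward. *)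
Lemma ge0_integral_dunkl mu (g : R * R -> \bar R) :
  measurable_fun [set: R * R] g -> (forall v, (0 <= g v)%E) ->
  (\int[dunkl_measure mu]_v g v =
   \int[lebesgue_measure \x lebesgue_measure]_v (g v * (dunkl_weight mu v)%:E))%E.
Proof.
move=> mg g0.
pose T2 := (measurableTypeR R * measurableTypeR R)%type.
have mid : measurable_fun [set: T2] (id : T2 -> R * R) by move=> _ A mA; rewrite setTI.
have w0 := dunkl_weight_ge0 mu.
have mw : measurable_fun [set: T2] (dunkl_weight mu).
  exact: (measurableT_comp (measurable_dunkl_weight mu) mid).
have mg2 : measurable_fun [set: T2] g by exact: (measurableT_comp mg mid).
rewrite -(@ge0_integral_density _ T2 R _ _ w0 mw _ mg2 g0).
have h := @ge0_integral_pushforward _ _ _ _ R _ mid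
  (@measure_of_density _ _ R (lebesgue_measure \x lebesgue_measure)%E _ w0 mw)
  setT g measurableT mg (fun v _ => g0 v).
exact: h.
Qed.

(** Decay of order 2 n in the Euclidean norm gives decay of order n in each
coordinate.  With n taken from [powR_decay], |f| times the weight is at most a
multiple of 1 / ((1 + v.1^2) (1 + v.2^2)), which is integrable by Tonelli. *)
Lemma schwartz_qL1 mu f : - (1 / 2) <= mu -> schwartz f -> qL1 mu f.
Proof.
move=> hmu [sf decay].
have mf : qcomp (fun h => measurable_fun [set: R * R] h) f.
  have [cf _] := sf 0%N.
  have [c1 c2 c3 c4] := qcomp_continuous f cf.
  by split; exact: continuous_measurable_plane.
split => //.
have s0 : 0 <= 2 * mu + 1 by lra.
have [n hn] := powR_decay _ s0.
have [C hC] := decay (0%N, 0%N) (n + n)%N.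
have Cb v : `|f v| * ((1 + `|v.1|) ^+ n * (1 + `|v.2|) ^+ n) <= C.
  apply: (@le_trans _ _ ((1 + euclidean_norm v) ^+ (n + n) * `|f v|)); last first.
    by apply: hC; exists v.
  rewrite mulrC ler_wpM2r// exprD.
  have e1 : `|v.1| <= euclidean_norm v.
    by rewrite /euclidean_norm -sqrtr_sqr ler_wsqrtr// lerDl sqr_ge0.
  have e2 : `|v.2| <= euclidean_norm v.
    by rewrite /euclidean_norm -sqrtr_sqr ler_wsqrtr// lerDr sqr_ge0.
  by apply: ler_pM; rewrite ?exprn_ge0 ?addr_ge0// lerXn2r ?nnegrE ?addr_ge0 ?sqrtr_ge0// lerD2l.
have C0 : 0 <= C.
  apply: le_trans (Cb (0, 0)).
  by rewrite !mulr_ge0// exprn_ge0// addr_ge0.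
have bound v : `|f v| * dunkl_weight mu v <= C * ((oneDsqr v.1)^-1 * (oneDsqr v.2)^-1).
  apply: (@le_trans _ _ (`|f v| * (((1 + `|v.1|) ^+ n * (oneDsqr v.1)^-1) *
      ((1 + `|v.2|) ^+ n * (oneDsqr v.2)^-1)))).
    by rewrite ler_wpM2l// ler_pM ?powR_ge0.
  have BD0 : 0 <= (oneDsqr v.1)^-1 * (oneDsqr v.2)^-1.
    by rewrite mulr_ge0 ?invr_ge0 ?oneDsqr_ge0.
  by rewrite [X in _ * X]mulrACA [leLHS]mulrA; exact: ler_wpM2r (Cb v).
have mo : measurable_fun [set: R] (fun x => (oneDsqr x)^-1 : R).
  by apply: continuous_measurable_fun; exact: continuous_oneDsqrV.
have mo2 : measurable_fun [set: R * R] (fun v => C * ((oneDsqr v.1)^-1 * (oneDsqr v.2)^-1)).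
  apply: measurable_funM; first exact: measurable_cst.
  by apply: measurable_funM; apply: (measurableT_comp mo).
rewrite /dunkl_norm1 ge0_integral_dunkl; last 2 first.
- by apply/measurable_EFinP; exact: measurable_quat_norm.
- by move=> v; rewrite lee_fin.
apply: (@le_lt_trans _ _ (\int[lebesgue_measure \x lebesgue_measure]_v
  (C * ((oneDsqr v.1)^-1 * (oneDsqr v.2)^-1))%:E)%E).
  apply: ge0_le_integral => //=.
  - by move=> v _; rewrite mule_ge0// lee_fin// dunkl_weight_ge0.
  - apply/measurable_EFinP; apply: measurable_funM; first exact: measurable_quat_norm.
    exact: measurable_dunkl_weight.
  - exact/measurable_EFinP.
  - by move=> v _; rewrite lee_fin.
rewrite fubini_tonelli1//=; last 2 first.
- exact/measurable_EFinP.
- by move=> v; rewrite lee_fin mulr_ge0// mulr_ge0 ?invr_ge0 ?oneDsqr_ge0.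
have I0 : (0 <= \int[lebesgue_measure]_x (oneDsqr x)^-1%:E :> \bar R)%E.
  by apply: integral_ge0 => x _; rewrite lee_fin invr_ge0.
have := integral_oneDsqr_lty; rewrite -ge0_fin_numE// => /fineK.
set i := fine _ => Ii.
have i0 : 0 <= i by exact: fine_ge0.
have Zl k : 0 <= k -> (\int[lebesgue_measure]_x (k%:E * (oneDsqr x)^-1%:E) = (k * i)%:E)%E.
  move=> k0; rewrite ge0_integralZl_EFin//; first by rewrite -Ii.
  - exact/measurable_EFinP.
rewrite [ltLHS](_ : _ =
    (\int[lebesgue_measure]_x ((C * i)%:E * (oneDsqr x)^-1%:E))%E).
  by rewrite Zl ?ltry// mulr_ge0.
apply: eq_integral => /=; move=> x _; rewrite /fubini_F/=.
under eq_integral do rewrite mulrA EFinM.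
rewrite Zl ?mulr_ge0 ?invr_ge0// -EFinM; congr EFin; ring.
Qed.

End Schwartz.

(** * The quadratic-phase transform *)
Section Transform.
Context {R : realType}.
Variables (mu : R) (a b c d e : R * R).
Hypothesis hmu : - (1 / 2) <= mu.
Implicit Types (f : R * R -> quat R) (v w : R * R).

Let mu1_gt0 : 0 < mu + 1. Proof. by have := hmu; lra. Qed.

Lemma imag_unit_i : qre (quat_i : quat R) = 0 /\ sqnormq (quat_i : quat R) = 1.
Proof. by split => //; rewrite sqnormqE /= !expr0n/= expr1n !addr0 add0r. Qed.

Lemma imag_unit_j : qre (quat_j : quat R) = 0 /\ sqnormq (quat_j : quat R) = 1.
Proof. by split => //; rewrite sqnormqE /= !expr0n/= expr1n !addr0 add0r. Qed.

Definition left_kernel w v := qpd_kernel mu quat_i a.1 b.1 c.1 d.1 e.1 w.1 v.1.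
Definition right_kernel w v := qpd_kernel mu quat_j a.2 b.2 c.2 d.2 e.2 w.2 v.2.
Definition QQPDT_integrand f w v := left_kernel w v * f v * right_kernel w v.

Definition kernel_bound : R := (`|b.1| `^ (mu + 1))^-1 * (`|b.2| `^ (mu + 1))^-1.

Let fst_cont : continuous (fst : R * R -> R). Proof. by move=> x; exact: cvg_fst. Qed.
Let snd_cont : continuous (snd : R * R -> R). Proof. by move=> x; exact: cvg_snd. Qed.

Let measA := @function_algebra_measurable R _ (R * R)%type.
Let contA := @function_algebra_continuous R (R * R)%type.

Lemma measurable_QQPDT_integrand f w : qcomp (fun h => measurable_fun [set: R * R] h) f ->
  qcomp (fun h => measurable_fun [set: R * R] h) (QQPDT_integrand f w).
Proof.
move=> mf; apply: (qcompM _ measA);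
  [apply: (qcompM _ measA _ _ _ mf)|];
  by apply: (qcomp_qpd_kernel _ measA _ mu1_gt0 _ _ _ _ _ _ (fun=> _)).
Qed.

Lemma continuous_QQPDT_integrand f v :
  qcomp (fun h => continuous h) (fun w => QQPDT_integrand f w v).
Proof.
have cc (r : R) : continuous ((fun=> r) : R * R -> R) by move=> x; exact: cvg_cst.
apply: (qcompM _ contA); last first.
  exact: (qcomp_qpd_kernel _ contA _ mu1_gt0 _ _ _ _ _ _ snd (fun=> _)).
apply: (qcompM _ contA).
  exact: (qcomp_qpd_kernel _ contA _ mu1_gt0 _ _ _ _ _ _ fst (fun=> _)).
exact: (qcomp_cst _ contA).
Qed.

Lemma QQPDT_integrand_le f w v : `|QQPDT_integrand f w v| <= kernel_bound * `|f v|.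
Proof.
have [i0 i1] := imag_unit_i; have [j0 j1] := imag_unit_j.
rewrite /QQPDT_integrand (quat_normM (left_kernel w v * f v)) (quat_normM (left_kernel w v)).
by rewrite mulrAC ler_wpM2r// ler_pM//; exact: normq_qpd_kernel.
Qed.

Lemma qL1_QQPDT_integrand f w : qL1 mu f -> qL1 mu (QQPDT_integrand f w).
Proof.
move=> f1; apply: (@qL1_dominated _ _ _ _ kernel_bound f1).
  exact: measurable_QQPDT_integrand f1.1.
exact: QQPDT_integrand_le.
Qed.

(** The bound on the integrand does not depend on w, so it dominates each of
the four parameter integrals. *)
Lemma QQPDT_continuous f : qL1 mu f -> continuous (QQPDT mu a b c d e f).
Proof.
move=> f1; apply: continuous_qcomp.
have ib : (dunkl_measure mu).-integrable [set: R * R]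
    (EFin \o (fun v => kernel_bound * `|f v|)).
  by have := integrableZl measurableT kernel_bound (qL1_norm_integrable _ _ f1).
have main (h : quat R -> R) :
    (forall q, `|h q| <= `|q|) ->
    (forall w, measurable_fun [set: R * R] (fun v => h (QQPDT_integrand f w v))) ->
    (forall v, continuous (fun w => h (QQPDT_integrand f w v))) ->
    continuous (fun w => dunkl_c mu ^+ 2 * \int[dunkl_measure mu]_v h (QQPDT_integrand f w v)).
  move=> h1 mh ch w; apply: cvgM; first exact: cvg_cst.
  apply: (continuous_Rintegral _ (fun w v => h (QQPDT_integrand f w v)) _ mh ib) => //.
  by move=> w' v; exact: le_trans (h1 _) (QQPDT_integrand_le _ _ _).
have M w := measurable_QQPDT_integrand f w f1.1.
have C v := continuous_QQPDT_integrand f v.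
split; apply: main => //; try (by move=> q; have [] := norm_component_le q);
  try (by move=> w; have [] := M w); by move=> v; have [] := C v.
Qed.

Lemma QQPDT_norm_le f w : qL1 mu f ->
  (`|QQPDT mu a b c d e f w|%:E <=
   (dunkl_c mu ^+ 2 / `|b.1 * b.2| `^ (mu + 1))%:E * dunkl_norm1 mu f)%E.
Proof.
move=> f1; rewrite /QQPDT normrZ ger0_norm ?sqr_ge0// EFinM.
have -> : dunkl_c mu ^+ 2 / `|b.1 * b.2| `^ (mu + 1) =
    dunkl_c mu ^+ 2 * kernel_bound.
  by rewrite /kernel_bound normrM powRM// invfM.
rewrite [in leRHS]EFinM -[leRHS]muleA lee_wpmul2l ?lee_fin ?sqr_ge0//.
apply: le_trans (qintegral_norm_le _ _ (qL1_QQPDT_integrand f w f1)) _.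
rewrite /dunkl_norm1 -ge0_integralZl_EFin//; last 2 first.
- by apply/measurable_EFinP; exact: measurable_quat_norm f1.1.
- by rewrite mulr_ge0 ?invr_ge0 ?powR_ge0.
apply: ge0_le_integral => //=.
- by apply/measurable_EFinP; apply: measurable_quat_norm; exact: measurable_QQPDT_integrand f1.1.
- by apply/measurable_EFinP; apply: measurable_funM => //; exact: measurable_quat_norm f1.1.
- by move=> v _; rewrite -EFinM lee_fin QQPDT_integrand_le.
Qed.

(** The factors independent of v stand at the outer ends of the product and
leave the integral on their own sides; the inner integrand is the one of the
QDT of the modulated function, at the rescaled point. *)
Lemma QQPDT_QDT f w : qL1 mu f ->
  QQPDT mu a b c d e f w =
      expq quat_i (- (c.1 * w.1 ^+ 2 + e.1 * w.1)) / powq quat_i b.1 (mu + 1) *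
      QDT mu
        (fun v : R * R =>
           expq quat_i (- (a.1 * v.1 ^+ 2 + d.1 * v.1)) * f v *
           expq quat_j (- (a.2 * v.2 ^+ 2 + d.2 * v.2)))
        (w.1 / b.1, w.2 / b.2) *
      (expq quat_j (- (c.2 * w.2 ^+ 2 + e.2 * w.2)) /
       powq quat_j b.2 (mu + 1)).
Proof.
move=> f1; have [i0 i1] := imag_unit_i; have [j0 j1] := imag_unit_j.
rewrite /QQPDT /QDT /=.
set P := _ / powq _ b.1 _; set Q := _ / powq _ b.2 _.
set G := fun v => _ * _ * dunkl_E _ _ _ _.
have mG : qcomp (fun h => measurable_fun [set: R * R] h) G.
  apply: (qcompM _ measA); last by apply: (qcomp_dunkl_E _ measA _ mu1_gt0 _ (fun=> _)).
  apply: (qcompM _ measA); first by apply: (qcomp_dunkl_E _ measA _ mu1_gt0 _ (fun=> _)).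
  apply: (qcompM _ measA); last by apply: (qcomp_chirp _ measA).
  by apply: (qcompM _ measA _ _ _ f1.1); apply: (qcomp_chirp _ measA).
have iG : qL1 mu G.
  apply: (@qL1_dominated _ _ _ _ 1 f1 mG) => v.
  rewrite /G !quat_normM !normq_expq// mul1r mulr1 mulrAC ler_piMl//.
  by rewrite mulr_ile1// normq_dunkl_E.
rewrite -scalerAr -scalerAl -qintegralMl; last exact: qL1_integrable.
rewrite -qintegralMr; last first.
  apply: qL1_integrable; apply: (@qL1_dominated _ _ _ _ `|P| iG).
    by apply: (qcompM _ measA _ _ _ mG); exact: (qcomp_cst _ measA).
  by move=> v; rewrite quat_normM.
congr (_ *: qintegral _ _); apply/funext => v.
rewrite qpd_kernelEl// qpd_kernelEr// -/P -/Q /G.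
by rewrite !mulrA.
Qed.

End Transform.

Theorem theorem3p1 (R : realType) (mu : R) (a b c d e : R * R)
    (hmu : - (1 / 2) <= mu) (hb1 : b.1 != 0) (hb2 : b.2 != 0) :
  (forall f : R * R -> quat R, dunkl_L1 mu f ->
    continuous (QQPDT mu a b c d e f) /\
    (forall w : R * R,
      (`|QQPDT mu a b c d e f w|%:E <=
       (dunkl_c mu ^+ 2 / `|b.1 * b.2| `^ (mu + 1))%:E * dunkl_norm1 mu f)%E))
  /\
  (forall f : R * R -> quat R, schwartz f ->
    forall w : R * R,
      QQPDT mu a b c d e f w =
      expq quat_i (- (c.1 * w.1 ^+ 2 + e.1 * w.1)) / powq quat_i b.1 (mu + 1) *
      QDT mu
        (fun v : R * R =>
           expq quat_i (- (a.1 * v.1 ^+ 2 + d.1 * v.1)) * f v *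
           expq quat_j (- (a.2 * v.2 ^+ 2 + d.2 * v.2)))
        (w.1 / b.1, w.2 / b.2) *
      (expq quat_j (- (c.2 * w.2 ^+ 2 + e.2 * w.2)) /
       powq quat_j b.2 (mu + 1))).
Proof.
have fA f : schwartz f -> qL1 mu f by exact: schwartz_qL1.
split=> [f [mf f1]|f sf w].
  have f1' : qL1 mu f by split => //; exact: qcomp_borel.
  split; first exact: QQPDT_continuous.
  by move=> w; exact: QQPDT_norm_le.
exact: QQPDT_QDT (fA _ sf).
Qed.
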